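(* For $n\geq 1$ let $x_{n,1}<x_{n,2}<\dots<x_{n,n}=0$ be the $n$ (real, distinct) roots of the Eulerian polynomial $A_n(x)=\sum_{k=1}^n A(n,k)x^k$, and let $$\mu_n=\frac{1}{n}\sum_{k=1}^n \delta_{-x_{n,k}}.$$ Then, as $n\to\infty$, the sequence of probability measures $\mu_n$ converges weakly to a probability measure $\mu$ with support $[0,\infty)$. This measure $\mu$ is the distribution of $\exp(\pi Z)$, where $Z$ is a standard Cauchy random variable; equivalently, $\mu$ has density $$\frac{1}{t\left(\log^2 t+\pi^2\right)}\,1_{t>0}.$$
   Context: For $1\leq k\leq n$, $A(n,k)$ denotes the Eulerian number, i.e. the number of permutations of $\{1,\dots,n\}$ with exactly $k-1$ descents. It is a classical fact that $A_n(x)=\sum_{k=1}^n A(n,k)x^k$ has $n$ distinct real roots, all nonpositive, the largest being $0$. $\delta_a$ denotes the Dirac mass at $a$. *)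

(* Defs.v *)
From HB Require Import structures.
From mathcomp Require Import all_boot all_order all_algebra all_fingroup.
From mathcomp Require Import all_classical all_reals all_analysis.
From mathcomp Require Import measurable_realfun.

Set Implicit Arguments.
Unset Strict Implicit.
Unset Printing Implicit Defensive.

Import Order.TTheory GRing.Theory Num.Theory.
Import numFieldNormedType.Exports.

Local Open Scope classical_set_scope.
Local Open Scope ring_scope.

Definition descents (n : nat) (s : 'S_n) : {set 'I_n} :=
  [set i : 'I_n | [exists j : 'I_n, (j == i.+1 :> nat) && (s j < s i)%N]].

(* [k] is one more than the number of descents, so [eulerian_number n 0 = 0]. *)
Definition eulerian_number (n k : nat) : nat :=
  #|[set s : 'S_n | #|descents s|.+1 == k]%SET|.

Definition eulerian_poly (R : realType) (n : nat) : {poly R} :=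
  \sum_(1 <= k < n.+1) (eulerian_number n k)%:R *: 'X^k.

(* [y 1], ..., [y n] are the roots of the n-th Eulerian polynomial, listed in
   increasing order (for 1 <= n); the other values of [y] are irrelevant. *)
Record eulerian_roots (R : realType) (n : nat) (y : nat -> R) : Prop :=
  EulerianRoots {
    eulerian_roots_incr : forall j k : nat,
      (1 <= j)%N -> (j < k)%N -> (k <= n)%N -> y j < y k ;
    eulerian_rootsP : forall z : R,
      root (eulerian_poly R n) z <-> exists2 k : nat, (1 <= k <= n)%N & z = y k ;
    eulerian_roots_max : y n = 0
  }.

(* [msum _ n] sums over 0 <= k < n, hence the shift to [y 1], ..., [y n]. *)
Definition root_measure (R : realType) (y : nat -> R) (n : nat) :
    set R -> \bar R :=
  mscale (n%:R^-1)%:nng (msum (fun k : nat => dirac (- y k.+1)) n).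

HB.instance Definition _ (R : realType) (y : nat -> R) (n : nat) :=
  Measure.on (@root_measure R y n).

Lemma root_measure_setT (R : realType) (y : nat -> R) (n : nat) :
  @root_measure R y n.+1 setT = 1%E.
Proof.
rewrite /root_measure /mscale /= /msum.
rewrite (eq_bigr (fun=> 1%:E)) => [|k _]; last exact: diracT.
by rewrite sumEFin -EFinM sumr_const card_ord mulVf// pnatr_eq0.
Qed.

HB.instance Definition _ (R : realType) (y : nat -> R) (n : nat) :=
  Measure_isProbability.Build _ _ _ (@root_measure R y n.+1)
    (@root_measure_setT R y n).

Definition weakly_converges (R : realType)
    (mu_ : nat -> probability R R) (mu : probability R R) : Prop :=
  forall f : R -> R, continuous f -> (exists M : R, forall t, `|f t| <= M) ->
    (\int[mu_ n]_t (f t)%:E)%E @[n --> \oo] --> (\int[mu]_t (f t)%:E)%E.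

Definition measure_support (R : realType) (mu : probability R R) : set R :=
  [set t | forall U : set R, open U -> U t -> (0 < mu U)%E].

Definition has_density (R : realType) (mu : probability R R) (f : R -> R) :
    Prop :=
  [/\ measurable_fun setT f, forall t, 0 <= f t &
      forall A : set R, measurable A ->
        mu A = (\int[@lebesgue_measure R]_(t in A) (f t)%:E)%E].

Definition standard_cauchy_pdf (R : realType) (t : R) : R :=
  (pi * (1 + t ^+ 2))^-1.

Definition exp_pi (d : measure_display) (T : measurableType d) (R : realType)
    (Z : T -> R) : T -> R :=
  fun w => expR (pi * Z w).

Lemma measurable_exp_pi (d : measure_display) (T : measurableType d)
  (R : realType) (Z : {mfun T >-> R}) : measurable_fun setT (exp_pi Z).
Proof.
by apply: measurableT_comp => //; exact: measurable_funM.
Qed.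

HB.instance Definition _ (d : measure_display) (T : measurableType d)
    (R : realType) (Z : {mfun T >-> R}) :=
  isMeasurableFun.Build _ _ _ _ (exp_pi Z) (measurable_exp_pi Z).

(* Main.v *)
(* Let [P_n] be the n-th Eulerian polynomial, with [P_0 = x].  For [n >= 1] the function
   [f_n = P_n / (1 - x)^(n+1)] is [(x d/dx)^n] applied to [1 / (1 - x)], so at
   [x = - e^u] it is the n-th derivative of [1 / (1 + e^u)], a sum of
   [(-1)^(n+1) n! (u + i pi (2m+1))^-(n+1)] over the poles.  That expansion is
   obtained here as the limit [N -> oo] of a finite identity: the decomposition over
   the N-th roots of -1.  The two poles nearest to the real line dominate, and with
   [u = pi cot theta] their contribution is
   [2 (-1)^(n+1) n! (sin theta / pi)^(n+1) cos ((n+1) theta)].  Hence the sign of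
   [P_n(- e^u)] alternates at [theta = j pi / (n+1)], which yields enough roots to see
   that the angles of the roots become equidistributed in ]0, pi[: this says that
   [u / pi = cot theta] is Cauchy in the limit. *)

Require Import Defs.
From HB Require Import structures.
From mathcomp Require Import all_boot all_order all_algebra all_fingroup.
From mathcomp Require Import all_classical all_reals all_analysis.
From mathcomp Require Import measurable_realfun complex ring lra zify.

Set Implicit Arguments.
Unset Strict Implicit.
Unset Printing Implicit Defensive.

Import Order.TTheory GRing.Theory Num.Theory.
Import numFieldNormedType.Exports.

Local Open Scope ring_scope.

(** * Permutations counted by descents *)

Lemma lift_perm_pair_bij n (j0 : 'I_n.+1) :
  bijective (fun p : 'I_n.+1 * 'S_n => lift_perm p.1 j0 p.2).
Proof.
apply: inj_card_bij; last by rewrite card_prod !card_Sn card_ord factS.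
move=> [i s] [j t] /= eq_lift; have ij : i = j.
  by apply: (@perm_inj _ (lift_perm i j0 s)); rewrite lift_perm_id eq_lift lift_perm_id.
rewrite -ij in eq_lift *; congr pair; apply/permP => k; apply: (@lift_inj _ j0).
by rewrite -!(lift_perm_lift i) eq_lift.
Qed.

Lemma sum_perm_lift (V : nmodType) n (j0 : 'I_n.+1) (F : 'S_n.+1 -> V) :
  \sum_s F s = \sum_i \sum_(t : 'S_n) F (lift_perm i j0 t).
Proof. by rewrite pair_bigA (reindex _ (onW_bij _ (lift_perm_pair_bij j0))). Qed.

Lemma descentP n (s : 'S_n) (k : 'I_n) :
  reflect (exists2 j : 'I_n, j = k.+1 :> nat & (s j < s k)%N) (k \in descents s).
Proof.
rewrite inE; apply: (iffP existsP) => [[j /andP[/eqP jk lt_s]]|[j jk lt_s]];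
  by exists j; rewrite ?jk ?eqxx.
Qed.

Lemma descent_ltn n (s : 'S_n) (k : 'I_n) : k \in descents s -> (k.+1 < n)%N.
Proof. by move=> /descentP[j <- _]. Qed.

Lemma card_descents_le n (s : 'S_n) : (#|descents s| <= n.-1)%N.
Proof.
case: n s => [|n] s; first by rewrite -[leqRHS](card_ord 0) max_card.
have /subset_leq_card : descents s \subset [set~ ord_max].
  apply/fintype.subsetP => k /descent_ltn; rewrite !inE; apply: contraTneq => ->.
  by rewrite /= ltnn.
by rewrite cardsC1 card_ord.
Qed.

Lemma mem_descents_lift n (i : 'I_n.+1) (t : 'S_n) (k : 'I_n) :
  (lift i k \in descents (lift_perm i ord_max t)) =
  (k \in descents t) && (k.+1 != i).
Proof.
apply/descentP/andP => [[j]|[/descentP[j jk lt_t] ki]].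
  rewrite lift_perm_lift lift_max; case: (unliftP i j) => [k'|] ->; last first.
    by rewrite lift_perm_id /= ltnNge ltnW // ltn_ord.
  rewrite lift_perm_lift lift_max /= /bump => k'k lt_t.
  split; [apply/descentP; exists k' => // |apply/eqP];
    by case: leqP k'k; case: leqP => /=; lia.
exists (lift i j); rewrite ?lift_perm_lift ?lift_max //= /bump jk.
by move/eqP: ki; case: leqP; case: leqP => /=; lia.
Qed.

Lemma max_position_descent n (i : 'I_n.+1) (t : 'S_n) :
  (i \in descents (lift_perm i ord_max t)) = (i != ord_max).
Proof.
apply/idP/idP => [/descent_ltn|i_neq].
  by apply: contraTneq => ->; rewrite /= ltnn.
have lt_i : (i.+1 < n.+1)%N by rewrite ltn_neqAle ltn_ord andbT eqSS.
apply/descentP; exists (Ordinal lt_i) => //.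
case: (unliftP i (Ordinal lt_i)) => [k ->|/(congr1 val) /= /eqP].
  by rewrite lift_perm_lift lift_perm_id lift_max; exact: ltn_ord.
by rewrite gtn_eqF.
Qed.

Lemma card_descents_lift n (i : 'I_n.+1) (t : 'S_n) :
  #|descents (lift_perm i ord_max t)| =
  ((i != ord_max) + #|[set k in descents t | k.+1 != i]|)%N.
Proof.
rewrite -!sum1_card big_mkcond (bigD1_ord i) //= max_position_descent -!big_mkcond.
by congr addn; apply: eq_bigl => k; rewrite mem_descents_lift [RHS]inE.
Qed.

(* Inserting the largest letter creates a descent, except at the end of the word
   and inside a descent. *)
Lemma card_descents_insert n (i : 'I_n.+1) (t : 'S_n) :
  #|descents (lift_perm i ord_max t)| =
  (#|descents t| + (i \notin ord_max |: [set lift ord0 k | k in descents t]))%N.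
Proof.
rewrite card_descents_lift !inE negb_or addnC.
have [->|i_neq] /= := eqVneq.
  congr addn; apply: eq_card => k; rewrite inE andb_idr // => /descent_ltn.
  by rewrite neq_ltn ltnS => ->.
case: imsetP => [[k k_desc ->]|no_desc].
  rewrite addn1 addn0 [RHS](cardsD1 k) k_desc; congr _.+1.
  by apply: eq_card => j; rewrite !inE /= /bump leq0n add1n eqSS andbC.
congr addn; apply: eq_card => k; rewrite inE andb_idr // => k_desc.
by apply/eqP => ki; apply: no_desc; exists k => //; apply/val_inj.
Qed.

Definition descent_poly (R : nzSemiRingType) n : {poly R} :=
  \sum_(s : 'S_n) 'X^(#|descents s|.+1).

Lemma sum_descents_insert (R : nzSemiRingType) n (t : 'S_n) (d := #|descents t|) :
  \sum_(i < n.+1) 'X^(#|descents (lift_perm i ord_max t)|.+1) =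
  d.+1%:R * 'X^(d.+1) + (n - d)%:R * 'X^(d.+2) :> {poly R}.
Proof.
pose A := ord_max |: [set lift ord0 k | k in descents t].
have cardA : #|A| = d.+1.
  rewrite cardsU1 card_imset; last exact: lift_inj.
  case: imsetP => // -[k /descent_ltn kn /(congr1 val)] /= /eqP.
  by rewrite gtn_eqF.
have cardCA : #|~: A| = (n - d)%N by rewrite cardsCs finset.setCK cardA card_ord subSS.
rewrite !mulr_natl (bigID [in A]) /= -[X in _ *+ X]cardA -cardCA -!sumr_const.
congr (_ + _); first by apply: eq_bigr => i iA; rewrite card_descents_insert -/A iA addn0.
apply: eq_big => i; first by rewrite finset.in_setC.
by move=> iA; rewrite card_descents_insert -/A iA addn1.
Qed.

Lemma descent_poly0 (R : nzSemiRingType) : descent_poly R 0 = 'X.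
Proof.
rewrite /descent_poly (eq_bigr (fun=> 'X)) => [|s _].
  by rewrite sumr_const card_Sn mulr1n.
by have := card_descents_le s; rewrite leqn0 => /eqP ->.
Qed.

Lemma descent_polyS (R : comNzRingType) n :
  descent_poly R n.+1 =
  'X * (1 - 'X) * (descent_poly R n)^`() + n.+1%:R * ('X * descent_poly R n).
Proof.
rewrite /descent_poly (sum_perm_lift ord_max) exchange_big linear_sum /= !mulr_sumr.
rewrite -big_split; apply: eq_bigr => t _ /=; rewrite sum_descents_insert.
have le_dn : (#|descents t| <= n)%N := leq_trans (card_descents_le t) (leq_pred n).
by rewrite derivXn -['X^_ *+ _]mulr_natl natrB // !exprS -!natr1; ring.
Qed.

Lemma map_descent_poly (R S : nzRingType) (f : {rmorphism R -> S}) n :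
  map_poly f (descent_poly R n) = descent_poly S n.
Proof. by rewrite rmorph_sum; apply: eq_bigr => s _; rewrite /= map_polyXn. Qed.

Lemma horner_descent_poly (R : comNzSemiRingType) n (x : R) :
  (descent_poly R n).[x] = \sum_(s : 'S_n) x ^+ #|descents s|.+1.
Proof. by rewrite horner_sum; apply: eq_bigr => s _; rewrite hornerXn. Qed.

Lemma horner_descent_poly1 (R : comNzSemiRingType) n : (descent_poly R n).[1] = n`!%:R.
Proof.
rewrite horner_descent_poly (eq_bigr (fun=> 1)) => [|s _]; last exact: expr1n.
by rewrite sumr_const card_Sn.
Qed.

Lemma norm_horner_descent_poly (R : numFieldType) n (z c : R) :
  1 <= c -> `|z| <= c -> `|(descent_poly R n.+1).[z]| <= n.+1`!%:R * c ^+ n.+1.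
Proof.
move=> c1 zc; rewrite horner_descent_poly (le_trans (ler_norm_sum _ _ _)) //.
rewrite -card_Sn mulr_natl -sumr_const; apply: ler_sum => s _.
rewrite normrX (le_trans (lerXn2r _ _ _ zc)) ?nnegrE ?(le_trans ler01 c1) //.
by rewrite ler_weXn2l // ltnS card_descents_le.
Qed.

Lemma eulerian_polyE (R : realType) n : eulerian_poly R n.+1 = descent_poly R n.+1.
Proof.
rewrite /eulerian_poly /descent_poly big_add1 /= big_mkord.
have lt_des (s : 'S_n.+1) : (#|descents s| < n.+1)%N := card_descents_le s.
rewrite [RHS](partition_big (fun s => Ordinal (lt_des s)) xpredT) //=.
apply: eq_bigr => k _; rewrite (eq_bigr (fun=> 'X^(k.+1))) => [|s /eqP <- //].
rewrite sumr_const scaler_nat; congr (_ *+ _).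
by apply: eq_card => s; rewrite inE eqSS.
Qed.

(** * Partial fractions over the N-th roots of -1 *)

(* With [f_n = P_n / (1 - x)^(n+1)], the recurrence says [x f_n' = f_(n+1)]; this is
   the same fact for [f_n (c x^d)], cleared of denominators. *)
Lemma comp_descent_polyS (R : comNzRingType) n (c : R) d :
  d%:R * (descent_poly R n.+1 \Po (c *: 'X^d)) =
  (1 - c *: 'X^d) * 'X * (descent_poly R n \Po (c *: 'X^d))^`()
    - n.+1%:R * ('X * (1 - c *: 'X^d)^`()) * (descent_poly R n \Po (c *: 'X^d)).
Proof.
set q : {poly R} := c *: 'X^d.
have derivq : 'X * q^`() = d%:R * q.
  rewrite /q derivZ derivXn -!scalerAr; congr (c *: _).
  by case: (d) => [|d']; rewrite ?mulr0n ?mulr0 ?mul0r // mulrnAr -exprS mulr_natl.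
rewrite descent_polyS deriv_comp derivB derivC sub0r -[n.+1%:R]polyC_natr.
rewrite comp_polyD !comp_polyM comp_polyB !comp_polyC comp_polyX.
transitivity ((1 - q) * ((descent_poly R n)^`() \Po q) * (d%:R * q)
    + n.+1%:R * (d%:R * q) * (descent_poly R n \Po q)); last by rewrite -derivq; ring.
by rewrite polyC_natr; ring.
Qed.

Section multisection.
Variables (R : comNzRingType) (N : nat) (eta : 'I_N -> R).
Hypotheses (N_gt0 : (0 < N)%N) (etaN : forall m, eta m ^+ N = -1)
  (sum_etaX : forall j, (0 < j < N)%N -> \sum_m eta m ^+ j = 0).

Let geom m : {poly R} := \sum_(j < N) (eta m *: 'X) ^+ j.

Lemma one_sub_etaX_geom m : (1 - eta m *: 'X) * geom m = 1 + 'X^N.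
Proof.
by rewrite -(opprB _ 1) mulNr -subrX1 exprZn etaN scaleN1r opprB opprK addrC.
Qed.

Lemma sum_geom : \sum_m geom m = N%:R.
Proof.
rewrite /geom exchange_big (bigD1 (Ordinal N_gt0)) //= [X in _ + X]big1 => [|j j_neq0].
  by rewrite addr0 (eq_bigr (fun=> 1)) // sumr_const card_ord.
under eq_bigr do rewrite exprZn.
by rewrite -scaler_suml sum_etaX ?scale0r // ltn_ord andbT lt0n.
Qed.

Lemma sum_etaX_geom : \sum_m (eta m *: 'X) * geom m = N%:R * - 'X^N.
Proof.
transitivity (\sum_m (geom m - (1 + 'X^N))).
  by apply: eq_bigr => m _; rewrite -(one_sub_etaX_geom m); ring.
by rewrite sumrB sum_geom sumr_const card_ord -mulr_natl; ring.
Qed.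

(* The identity is [N^(n+1) f_n(-x^N) = \sum_m f_n(eta_m x)], cleared of denominators
   by means of [one_sub_etaX_geom]. *)
Lemma descent_poly_multisection n :
  N%:R ^+ n.+1 * (descent_poly R n \Po (- 'X^N)) =
  \sum_m (descent_poly R n \Po (eta m *: 'X)) * geom m ^+ n.+1.
Proof.
elim: n => [|n IH].
  rewrite descent_poly0 comp_polyX expr1 -sum_etaX_geom.
  by apply: eq_bigr => m _; rewrite comp_polyX expr1.
have := comp_descent_polyS n (-1 : R) N; rewrite scaleN1r opprK => recN.
rewrite exprSr -mulrA recN.
transitivity ((1 + 'X^N) * 'X * (N%:R ^+ n.+1 * (descent_poly R n \Po - 'X^N))^`()
    - n.+1%:R * ('X * (1 + 'X^N)^`()) * (N%:R ^+ n.+1 * (descent_poly R n \Po - 'X^N))).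
  by rewrite -natrX -[(N ^ _)%:R]polyC_natr derivM derivC; ring.
rewrite IH raddf_sum /= !mulr_sumr -sumrB; apply: eq_bigr => m _.
have := comp_descent_polyS n (eta m) 1; rewrite mul1r expr1 => ->.
rewrite derivM deriv_exp /= -(one_sub_etaX_geom m) derivM.
by rewrite -mulr_natl !exprS; ring.
Qed.

End multisection.

Lemma descent_poly_partial_fractions (F : fieldType) N (eta : 'I_N -> F) n (x : F) :
  (0 < N)%N -> (forall m, eta m ^+ N = -1) ->
  (forall j, (0 < j < N)%N -> \sum_m eta m ^+ j = 0) -> 1 + x ^+ N != 0 ->
  N%:R ^+ n.+1 * ((descent_poly F n).[- x ^+ N] / (1 + x ^+ N) ^+ n.+1) =
  \sum_m (descent_poly F n).[eta m * x] / (1 - eta m * x) ^+ n.+1.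
Proof.
move=> N_gt0 etaN sum_etaX xN.
have /(congr1 (horner^~ x)) := descent_poly_multisection N_gt0 etaN sum_etaX n.
rewrite hornerM -natrX -[(N ^ _)%:R]polyC_natr hornerC natrX horner_comp hornerN hornerXn.
rewrite mulrA => ->; rewrite horner_sum mulr_suml; apply: eq_bigr => m _.
have /(congr1 (horner^~ x)) := one_sub_etaX_geom etaN m.
rewrite !hornerM horner_exp horner_comp; set g := (\sum_(j < N) _).[x].
rewrite !hornerE /= => geomE; rewrite -geomE exprMn invfM.
have g0 : g != 0 by apply: contraNneq xN => g0; rewrite -geomE g0 mulr0.
by rewrite -mulrA [_ * (_ / _)]mulrC mulrVK ?unitfE ?expf_neq0.
Qed.

Section cis.
Context {R : realType}.
Implicit Types a b w : R.

Definition cis a : R[i] := Complex (cos a) (sin a).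

Lemma cis0 : cis 0 = 1.
Proof. by rewrite /cis cos0 sin0. Qed.

Lemma cispi : cis pi = -1.
Proof. by apply/eqP; rewrite /cis cospi sinpi eq_complex /= oppr0 !eqxx. Qed.

Lemma cisD a b : cis (a + b) = cis a * cis b.
Proof. by apply/eqP; rewrite /cis cosD sinD eq_complex /= eqxx addrC eqxx. Qed.

Lemma cisX a n : cis a ^+ n = cis (n%:R * a).
Proof.
elim: n => [|n IH]; first by rewrite mul0r cis0 expr0.
by rewrite exprS IH -cisD -natr1 mulrDl mul1r addrC.
Qed.

Lemma cis_natpi n : cis (n%:R * pi) = (-1) ^+ n.
Proof. by rewrite -cisX cispi. Qed.

Lemma conjc_cis a : conjc (cis a) = cis (- a).
Proof. by rewrite /cis cosN sinN. Qed.

Lemma norm_cis a : `|cis a| = 1.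
Proof. by rewrite normc_def /= cos2Dsin2 sqrtr1. Qed.

Lemma cos_half_angle a : cos a = 1 - 2 * sin (a / 2) ^+ 2.
Proof. by rewrite {1}[a]splitr cosD -!expr2; have := cos2Dsin2 (a / 2); lra. Qed.

Lemma sqr_norm_one_sub_cis w a :
  `|1 - w%:C%C * cis a| ^+ 2 = ((1 - w) ^+ 2 + 4 * w * sin (a / 2) ^+ 2)%:C%C.
Proof.
rewrite -add_Re2_Im2 /=; congr (_%:C)%C.
transitivity (1 - 2 * w * cos a + w ^+ 2 * (cos a ^+ 2 + sin a ^+ 2)); first by ring.
by rewrite cos2Dsin2 cos_half_angle; ring.
Qed.

Lemma cis_neq1 a : 0 < a < 2 * pi -> cis a != 1.
Proof.
move=> /andP[a_gt0 a_lt]; rewrite eq_complex negb_and /= cos_half_angle.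
have : 0 < sin (a / 2) by apply: sin_gt0_pi; apply/andP; split; lra.
by move=> s_gt0; apply/orP; left; apply/eqP; nra.
Qed.

Definition odd_pi (m : nat) : R := m.*2.+1%:R * pi.

Lemma odd_pi0 : odd_pi 0 = pi.
Proof. exact: mul1r. Qed.

Lemma odd_pi_rev_ord N (m : 'I_N) : odd_pi (rev_ord m) = N.*2%:R * pi - odd_pi m.
Proof.
rewrite /odd_pi -mulrBl; congr (_ * _); apply/eqP; rewrite eq_sym subr_eq -natrD eqr_nat /=.
by have := ltn_ord m; lia.
Qed.

Lemma cis_odd_piX N m : (0 < N)%N -> cis (odd_pi m / N%:R) ^+ N = -1.
Proof.
move=> N_gt0; rewrite cisX mulrC divfK ?pnatr_eq0 -?lt0n // cis_natpi.
by rewrite -signr_odd /= odd_double.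
Qed.

Lemma sum_cis_odd_piX N j : (0 < j < N)%N ->
  \sum_(m < N) cis (odd_pi m / N%:R) ^+ j = 0.
Proof.
move=> /andP[j_gt0 jN]; have N_gt0 : (0 < N)%N := ltn_trans j_gt0 jN.
have N_neq0 : N%:R != 0 :> R by rewrite pnatr_eq0 -lt0n.
pose r := j.*2%:R * pi / N%:R : R.
transitivity (cis (j%:R * pi / N%:R) * \sum_(m < N) cis r ^+ m).
  rewrite mulr_sumr; apply: eq_bigr => m _; rewrite !cisX -cisD; congr cis.
  by rewrite /r /odd_pi -natr1 -!muln2 !natrM; ring.
have r_neq1 : cis r - 1 != 0.
  rewrite subr_eq0 cis_neq1 // /r -muln2 natrM; apply/andP; split.
    by rewrite !mulr_gt0 ?invr_gt0 ?ltr0n ?pi_gt0.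
  have lt_jN : j%:R < N%:R :> R by rewrite ltr_nat.
  by rewrite ltr_pdivrMr ?ltr0n // -mulrA mulrC ltr_pM2l // mulr_gt0 ?pi_gt0.
suff : (cis r - 1) * \sum_(m < N) cis r ^+ m == 0.
  by rewrite mulf_eq0 (negPf r_neq1) => /eqP ->; rewrite mulr0.
rewrite -subrX1 cisX mulrC divfK // cis_natpi -signr_odd odd_double.
by rewrite subrr.
Qed.

End cis.

Section pole_term.
Context {R : realType}.
Implicit Types (n N m : nat) (u c : R).

(* In the limit [N -> oo], the contribution to [f_n(- e^u)] of the pole [i c] of
   [1 / (1 + e^u)], where [c] is an odd multiple of [pi]. *)
Definition pole_term n N u c : R[i] :=
  let z := (expR (u / N%:R))%:C%C * cis (c / N%:R) in
  (descent_poly R[i] n).[z] / (N%:R * (1 - z)) ^+ n.+1.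

Lemma sum_pole_term n N u : (0 < N)%N ->
  ((descent_poly R n).[- expR u] / (1 + expR u) ^+ n.+1)%:C%C =
  \sum_(m < N) pole_term n N u (odd_pi m).
Proof.
move=> N_gt0; pose w := expR (u / N%:R).
have wN : w%:C%C ^+ N = (expR u)%:C%C.
  by rewrite -rmorphXn /= -expRM_natl mulrC divfK // pnatr_eq0 -lt0n.
have N_neq0 : N%:R ^+ n.+1 != 0 :> R[i] by rewrite expf_neq0 // pnatr_eq0 -lt0n.
have wN1 : 1 + w%:C%C ^+ N != 0.
  by rewrite wN -(rmorph1 (real_complex R)) -rmorphD fmorph_eq0 gt_eqF.
have := descent_poly_partial_fractions n N_gt0 (fun m : 'I_N => cis_odd_piX m N_gt0)
  (@sum_cis_odd_piX _ _) wN1.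
rewrite wN -(map_descent_poly (real_complex R)) -!rmorphN -(rmorph1 (real_complex R)).
rewrite -rmorphD horner_map -rmorphXn /= => sumE; apply: (mulfI N_neq0).
rewrite rmorphM fmorphV /= sumE mulr_sumr; apply: eq_bigr => m _.
rewrite map_descent_poly /pole_term [cis _ * _]mulrC exprMn invfM.
by rewrite [RHS]mulrCA mulVKf.
Qed.

Lemma pole_termD n N u c : (0 < N)%N ->
  pole_term n N u (c + N.*2%:R * pi) = pole_term n N u c.
Proof.
move=> N_gt0; rewrite /pole_term mulrDl -muln2 natrM.
have -> : N%:R * 2 * pi / N%:R = 2%:R * pi :> R by field; rewrite pnatr_eq0 -lt0n.
by rewrite cisD cis_natpi sqrrN expr1n mulr1.
Qed.

Lemma pole_termN n N u c : pole_term n N u (- c) = conjc (pole_term n N u c).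
Proof.
rewrite /pole_term mulNr -conjc_cis; set w := expR _; set e := cis _.
have -> : w%:C%C * conjc e = conjc (w%:C%C * e) by rewrite -[in LHS](conjc_real w) rmorphM.
rewrite -{1}(map_descent_poly (@conjc R)) horner_map.
by rewrite [RHS]rmorphM fmorphV rmorphXn [in RHS]rmorphM rmorphB rmorph1 rmorph_nat.
Qed.

Lemma pole_term_rev_ord n N u (m : 'I_N) :
  pole_term n N u (odd_pi (rev_ord m)) =
  conjc (pole_term n N u (odd_pi m)).
Proof.
rewrite odd_pi_rev_ord addrC pole_termD ?pole_termN //.
exact: leq_ltn_trans (ltn_ord m).
Qed.

End pole_term.

Local Open Scope classical_set_scope.
Local Open Scope ring_scope.

(** * The dominant poles *)

HB.instance Definition _ (R : rcfType) := NormedModule.copy R[i] (R[i]^o).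

Section complex_limits.
Context {R : realType} {T : Type} {F : set_system T} {FF : Filter F}.

Lemma cvg_real_complex (f : T -> R) (a : R) :
  f x @[x --> F] --> a -> (f x)%:C%C @[x --> F] --> a%:C%C.
Proof.
move=> /cvgrPdist_lt fa; apply/cvgrPdist_lt => e; rewrite ltcE => /andP[/eqP e_im e_gt0].
near=> x; rewrite -rmorphB normc_def /= expr0n addr0 sqrtr_sqr ltcE /= e_im eqxx.
by near: x; exact: fa.
Unshelve. all: by end_near. Qed.

Lemma cvg_Complex (f g : T -> R) (a b : R) :
  f x @[x --> F] --> a -> g x @[x --> F] --> b ->
  Complex (f x) (g x) @[x --> F] --> Complex a b.
Proof.
move=> fa gb; rewrite [Complex a b]complexE.
under eq_fun do rewrite [Complex _ _]complexE /=.
apply: cvgD; first exact: cvg_real_complex.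
by apply: cvgM; [exact: cvg_cst|exact: cvg_real_complex].
Qed.

Lemma cvg_complex_Re (f : T -> R[i]) (a : R[i]) :
  f x @[x --> F] --> a -> complex.Re (f x) @[x --> F] --> complex.Re a.
Proof.
move=> /cvgrPdist_lt fa; apply/cvgrPdist_lt => e e_gt0.
near=> x; rewrite -ltcR -raddfB (le_lt_trans (normc_ge_Re _)) //.
by near: x; apply: fa; rewrite ltcR.
Unshelve. all: by end_near. Qed.

End complex_limits.

Lemma cvg_horner (K : numFieldType) {T} {F : set_system T} {FF : Filter F}
    (p : {poly K}) (f : T -> K) (a : K) :
  f x @[x --> F] --> a -> p.[f x] @[x --> F] --> p.[a].
Proof.
move=> fa; elim/poly_ind: p => [|p c IH].
  by rewrite horner0; under eq_fun do rewrite horner0; exact: cvg_cst.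
rewrite hornerMXaddC; under eq_fun do rewrite hornerMXaddC.
by apply: cvgD; [exact: cvgM|exact: cvg_cst].
Qed.

Lemma cvgX (K : numFieldType) {T} {F : set_system T} {FF : Filter F}
    (f : T -> K) (a : K) n :
  f x @[x --> F] --> a -> f x ^+ n @[x --> F] --> a ^+ n.
Proof.
by move=> /(@cvg_horner _ _ _ _ 'X^n); rewrite hornerXn; under eq_fun do rewrite hornerXn.
Qed.

Section rescaling.
Context {R : realType}.
Implicit Types (f : R -> R) (c l : R).

Lemma cvg_divn c : c / n%:R @[n --> \oo] --> 0.
Proof.
have := cvgM (cvg_cst c) (@cvg_harmonic R).
by rewrite mulr0 -[X in _ -> X](cvg_shiftS (fun n => c / n%:R)); exact.
Qed.

Lemma cvg_comp_divn f c : {for 0, continuous f} -> f (c / n%:R) @[n --> \oo] --> f 0.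
Proof. by move=> cf; exact: (cvg_comp _ _ (cvg_divn c) cf). Qed.

Lemma cvg_difference_quotient f c l : is_derive (0 : R) (1 : R) f l ->
  n%:R * (f (c / n%:R) - f 0) @[n --> \oo] --> c * l.
Proof.
move=> df.
have d_scale : is_derive (0 : R) (1 : R) (fun h => c * h) c.
  by have := is_deriveZ c (is_derive_id (0 : R) (1 : R)); rewrite [c *: 1]mulr1.
have [derf <-] : is_derive (0 : R) (1 : R) (f \o (fun h => c * h)) (c * l).
  by rewrite mulrC; apply: is_derive1_comp; rewrite mulr0.
rewrite -(cvg_shiftS (fun n => n%:R * (f (c / n%:R) - f 0))).
have /cvgr_dnbhsP /(_ harmonic) /= dq := derf.
have := dq (conj (fun n => lt0r_neq0 (harmonic_gt0 n)) cvg_harmonic).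
apply: cvg_trans; apply: near_eq_cvg; near=> n.
by rewrite /harmonic /= invrK addr0 [_ *: 1]mulr1 mulr0.
Unshelve. all: by end_near. Qed.

End rescaling.

Section dominant_pole.
Context {R : realType}.
Implicit Types u c : R.

Lemma cvg_expR_divn u : expR (u / N%:R) @[N --> \oo] --> (1 : R).
Proof. by have := cvg_comp_divn u (@continuous_expR R 0); rewrite expR0. Qed.

Lemma cvg_cis_divn c : cis (c / N%:R) @[N --> \oo] --> (1 : R[i]).
Proof.
rewrite -cis0; apply: cvg_Complex.
  by apply: cvg_comp_divn; exact: continuous_cos.
by apply: cvg_comp_divn; exact: continuous_sin.
Qed.

Lemma cvg_pole_denominator u c :
  N%:R * (1 - (expR (u / N%:R))%:C%C * cis (c / N%:R)) @[N --> \oo] -->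
  - Complex u c.
Proof.
have -> : - Complex u c = - (1 * Complex 0 c + u%:C%C).
  by rewrite mul1r; apply/eqP; rewrite eq_complex /= add0r addr0 !eqxx.
have dexp := cvg_difference_quotient (c := u) (is_derive_expR 0).
have dcos := cvg_difference_quotient (c := c) (is_derive_cos 0).
have dsin := cvg_difference_quotient (c := c) (is_derive_sin 0).
rewrite expR0 mulr1 in dexp; rewrite cos0 sin0 oppr0 mulr0 in dcos.
rewrite sin0 cos0 mulr1 in dsin.
have : - ((expR (u / N%:R))%:C%C *
      Complex (N%:R * (cos (c / N%:R) - 1)) (N%:R * (sin (c / N%:R) - 0))
    + (N%:R * (expR (u / N%:R) - 1))%:C%C) @[N --> \oo] --> - (1 * Complex 0 c + u%:C%C).
  apply: cvgN; apply: cvgD.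
    apply: cvgM; last exact: cvg_Complex.
    by apply: cvg_real_complex; exact: cvg_expR_divn.
  exact: cvg_real_complex.
apply: cvg_trans; apply: near_eq_cvg; near=> N.
rewrite -(rmorph_nat (real_complex R)); apply/eqP; rewrite eq_complex /=.
by apply/andP; split; apply/eqP; ring.
Unshelve. all: by end_near. Qed.

Lemma cvg_pole_term n u c : Complex u c != 0 ->
  pole_term n N u c @[N --> \oo] --> n`!%:R / (- Complex u c) ^+ n.+1.
Proof.
move=> uc_neq0; apply: cvgM.
  rewrite -horner_descent_poly1 -[X in _.[X]]mulr1; apply: cvg_horner; apply: cvgM.
    by apply: cvg_real_complex; exact: cvg_expR_divn.
  exact: cvg_cis_divn.
apply: cvgV; first by rewrite expf_neq0 // oppr_eq0.
by apply: cvgX; exact: cvg_pole_denominator.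
Qed.

End dominant_pole.

(** * The other poles *)

Section sine_lower_bound.
Context {R : realType}.
Implicit Types x : R.

Lemma mul_cos_le_sin x : 0 <= x <= pi -> x * cos x <= sin x.
Proof.
move=> /andP[x_ge0 x_le].
have [y] : exists2 y, y \in `[0, x] & sin x - sin 0 = cos y * (x - 0).
  apply: MVT_segment => //; apply: continuous_subspaceT => y; exact: continuous_sin.
rewrite sin0 !subr0 in_itv /= => /andP[y_ge0 y_le] ->.
rewrite mulrC ler_wpM2r // leNgt ltr_cos ?in_itv /= -?leNgt //;
  by apply/andP; split; lra.
Qed.

Lemma half_le_sin x : 0 <= x <= pi / 2 -> x / 2 <= sin x.
Proof.
move=> /andP[x_ge0 x_le].
have cos_ge0 : 0 <= cos x by apply: cos_ge0_pihalf; apply/andP; split; lra.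
have cos2_ge0 : 0 <= cos (x / 2) by apply: cos_ge0_pihalf; apply/andP; split; lra.
have le_sin2 : x / 2 * cos (x / 2) <= sin (x / 2).
  by apply: mul_cos_le_sin; apply/andP; split; lra.
have -> : sin x = 2 * sin (x / 2) * cos (x / 2) by rewrite {1}[x]splitr sinD; ring.
have cosE : cos x = 2 * cos (x / 2) ^+ 2 - 1.
  by rewrite cos_half_angle; have := cos2Dsin2 (x / 2); lra.
nra.
Qed.

Lemma sum_inv_odd_sqr M : \sum_(m < M) (m.*2.+3%:R ^+ 2)^-1 <= 1 / 4 :> R.
Proof.
suff : \sum_(m < M) (m.*2.+3%:R ^+ 2)^-1 <= 1 / 4 - (4 * M.+1%:R)^-1 :> R.
  by move=> /le_trans; apply; rewrite gerBl invr_ge0 mulr_ge0.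
elim: M => [|M IH]; first by rewrite big_ord0 mulr1 div1r subrr.
rewrite big_ord_recr /= (le_trans (lerD IH (lexx _))) //.
have -> : M.*2.+3%:R = 2 * M%:R + 3 :> R by rewrite -addn3 natrD -mul2n natrM.
rewrite -[M.+1%:R]natr1 -[M.+2%:R]natr1 -[M.+1%:R]natr1.
move: M%:R (ler0n R M) => x x_ge0.
have le_inv : ((2 * x + 3) ^+ 2)^-1 <= (4 * (x + 1) * (x + 2))^-1.
  by rewrite lef_pV2 ?posrE ?exprn_gt0 ?mulr_gt0 //; [nra|lra|lra|lra].
have telescope : (4 * (x + 1) * (x + 2))^-1 = (4 * (x + 1))^-1 - (4 * (x + 1 + 1))^-1.
  by field; apply/andP; split; apply: lt0r_neq0; lra.
lra.
Qed.

End sine_lower_bound.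

Section other_poles.
Context {R : realType}.
Implicit Types (N : nat) (w : R).

(* The distance, in units of [pi], of the m-th odd multiple of [pi] to [2 N pi Z]. *)
Definition odd_dist N (m : 'I_N) : nat := minn m.*2.+1 (rev_ord m).*2.+1.

Lemma inv_sqr_odd_dist_le N (m : 'I_N) :
  ((odd_dist m)%:R ^+ 2)^-1 <=
  (m.*2.+1%:R ^+ 2)^-1 + ((rev_ord m).*2.+1%:R ^+ 2)^-1 :> R.
Proof.
by rewrite /odd_dist; case: leqP => _; rewrite ?lerDl ?lerDr invr_ge0 sqr_ge0.
Qed.

Lemma odd_dist_le_sin N (m : 'I_N) :
  (odd_dist m)%:R * pi / 4 <= N%:R * sin (odd_pi m / N%:R / 2) :> R.
Proof.
have N_gt0 : 0 < N%:R :> R by rewrite ltr0n (leq_ltn_trans _ (ltn_ord m)).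
wlog le_rev : m / (m <= rev_ord m)%N => [sin_ge|].
  have [|/ltnW le_rev] := leqP m (rev_ord m); first exact: sin_ge.
  have := sin_ge (rev_ord m); rewrite /odd_dist rev_ordK minnC => /(_ le_rev).
  have -> : odd_pi (rev_ord m) / N%:R / 2 = pi - odd_pi m / N%:R / 2 :> R.
    by rewrite odd_pi_rev_ord -muln2 natrM; field; rewrite gt_eqF.
  by rewrite sinB sinpi cospi mul0r sub0r mulN1r opprK.
have le_odd_pi : odd_pi m <= odd_pi (rev_ord m) :> R.
  by rewrite ler_pM2r ?pi_gt0 // ler_nat ltnS leq_double.
have le_pihalf : odd_pi m / N%:R / 2 <= pi / 2 :> R.
  rewrite ler_pM2r // ler_pdivrMr //; move: le_odd_pi.
  by rewrite odd_pi_rev_ord -muln2 natrM; lra.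
have ge0 : 0 <= odd_pi m / N%:R / 2 :> R.
  by rewrite !divr_ge0 ?mulr_ge0 ?pi_ge0 ?(ltW N_gt0).
rewrite /odd_dist (minn_idPl _) ?ltnS ?leq_double // -ler_pdivrMl //.
rewrite [leLHS](_ : _ = odd_pi m / N%:R / 2 / 2); first by rewrite half_le_sin // ge0.
by rewrite /odd_pi; field; rewrite gt_eqF.
Qed.

Lemma sqr_norm_pole_denominator_ge N (m : 'I_N) w : 0 <= w ->
  ((N%:R * (1 - w)) ^+ 2 + w * ((odd_dist m)%:R * pi) ^+ 2 / 4)%:C%C <=
  `|N%:R * (1 - w%:C%C * cis (odd_pi m / N%:R))| ^+ 2.
Proof.
move=> w_ge0; rewrite normrM [in leRHS]exprMn normr_nat sqr_norm_one_sub_cis.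
rewrite -(rmorph_nat (real_complex R)) -rmorphXn -rmorphM lecR.
rewrite [in leRHS]mulrDr exprMn lerD2l.
have : ((odd_dist m)%:R * pi / 4) ^+ 2 <=
    (N%:R * sin (odd_pi m / N%:R / 2)) ^+ 2 :> R.
  have d_ge0 : 0 <= (odd_dist m)%:R * pi / 4 :> R by rewrite divr_ge0 ?mulr_ge0 ?pi_ge0.
  by rewrite lerXn2r ?nnegrE ?odd_dist_le_sin // (le_trans d_ge0) ?odd_dist_le_sin.
by move=> /(ler_wpM2l w_ge0); set s := sin _; lra.
Qed.

End other_poles.

Section other_poles_bound.
Context {R : realType}.
Implicit Types (k N : nat) (u w a : R).

Lemma norm_horner_descent_poly_cis k w a : 0 <= w -> w ^+ k.+1 <= 2 ->
  `|(descent_poly R[i] k.+1).[w%:C%C * cis a]| <= (2 * k.+1`!%:R)%:C%C.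
Proof.
move=> w_ge0 wX_le2; have max_ge1 : 1 <= (Num.max 1 w)%:C%C.
  by rewrite -(rmorph1 (real_complex R)) lecR le_max lexx.
have norm_le : `|w%:C%C * cis a| <= (Num.max 1 w)%:C%C.
  by rewrite normrM norm_cis mulr1 ger0_norm ?ler0c // lecR le_max lexx orbT.
apply: le_trans (norm_horner_descent_poly _ max_ge1 norm_le) _.
rewrite -rmorphXn -(rmorph_nat (real_complex R)) -rmorphM lecR mulrC ler_wpM2r //.
by case: (leP 1 w) => //= _; rewrite expr1n ler1n.
Qed.

(* Lies strictly between the distance from [u] to the poles [+- i pi] and the distance
   from [u] to the other ones. *)
Definition gap_radius u : R := Num.sqrt (u ^+ 2 + 3 / 2 * pi ^+ 2).

Lemma sqr_gap_radius u : gap_radius u ^+ 2 = u ^+ 2 + 3 / 2 * pi ^+ 2.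
Proof. by rewrite sqr_sqrtr // addr_ge0 ?sqr_ge0 // mulr_ge0 ?sqr_ge0. Qed.

Lemma gap_radius_gt0 u : 0 < gap_radius u.
Proof.
by rewrite sqrtr_gt0 ltr_wpDl ?sqr_ge0 // mulr_gt0 // exprn_gt0 // pi_gt0.
Qed.

(* Of the [k + 2] factors of the denominator, [k] are compared with [gap_radius u] and
   the last two with [odd_dist m], which makes the bound summable over [m].
   The slack [8 / 9] and [- 1] in the hypotheses is absorbed by the gap between
   [3 / 2] and [3 ^ 2 / 4]. *)
Lemma norm_pole_term_le k u N (m : 'I_N) : (3 <= odd_dist m)%N ->
  8 / 9 <= expR (u / N%:R) -> expR (u / N%:R) ^+ k.+1 <= 2 ->
  u ^+ 2 - 1 <= (N%:R * (1 - expR (u / N%:R))) ^+ 2 ->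
  `|pole_term k.+1 N u (odd_pi m)| <=
  (2 * k.+1`!%:R / gap_radius u ^+ k *
    (2 / (odd_dist m)%:R ^+ 2))%:C%C.
Proof.
set w := expR _ => dist_ge3 w_ge wX_le2 Nw_ge; rewrite /pole_term -/w; set Z := _ * (1 - _).
set b : R := (odd_dist m)%:R; have q_gt0 := gap_radius_gt0 u.
have [D D_ge0 normZ] : exists2 D : R, 0 <= D & `|Z| = D%:C%C.
  by rewrite normc_def; exists (Num.sqrt ((complex.Re Z) ^+ 2 + (complex.Im Z) ^+ 2)).
have := sqr_norm_pole_denominator_ge m (expR_ge0 _ : 0 <= w).
rewrite -/Z normZ -rmorphXn lecR exprMn -/b => D2_ge.
have pi2_ge4 : 4 <= pi ^+ 2 :> R by have := @pi_ge2 R; nra.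
have b2_ge9 : 9 <= b ^+ 2 by have : 3 <= b :> R; [rewrite ler_nat|nra].
have wb2_ge : 8 / 9 * (b ^+ 2 * pi ^+ 2) <= w * (b ^+ 2 * pi ^+ 2).
  by rewrite ler_wpM2r // mulr_ge0 ?sqr_ge0.
have [q2_le b2_le] : gap_radius u ^+ 2 <= D ^+ 2 /\ b ^+ 2 / 2 <= D ^+ 2.
  by rewrite sqr_gap_radius; split; nra.
have q_le : gap_radius u <= D by rewrite -(ler_pXn2r (n := 2)) ?nnegrE // ltW.
have D_gt0 : 0 < D := lt_le_trans q_gt0 q_le.
rewrite normrM normfV normrX normZ -rmorphXn -fmorphV /=.
apply: (@le_trans _ _ ((2 * k.+1`!%:R)%:C%C * ((D ^+ k.+2)^-1)%:C%C)).
  apply: ler_wpM2r; first by rewrite ler0c invr_ge0 exprn_ge0.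
  by apply: norm_horner_descent_poly_cis; rewrite ?expR_ge0.
rewrite -rmorphM lecR -mulrA ler_wpM2l ?mulr_ge0 // -(addn2 k) exprD invfM.
rewrite ler_pM ?invr_ge0 ?exprn_ge0 //.
  by rewrite lef_pV2 ?posrE ?exprn_gt0 // lerXn2r ?nnegrE // ltW.
by rewrite -invf_div lef_pV2 ?posrE ?exprn_gt0 //; lra.
Qed.

Lemma norm_sum_other_poles_le k u M :
  8 / 9 <= expR (u / M.+2%:R) -> expR (u / M.+2%:R) ^+ k.+1 <= 2 ->
  u ^+ 2 - 1 <= (M.+2%:R * (1 - expR (u / M.+2%:R))) ^+ 2 ->
  `|\sum_(m < M) pole_term k.+1 M.+2 u (odd_pi m.+1)| <=
  (2 * k.+1`!%:R / gap_radius u ^+ k)%:C%C.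
Proof.
move=> w_ge wX_le2 Nw_ge; apply: le_trans (ler_norm_sum _ _ _) _.
set B := _ / _; have B_ge0 : 0 <= B.
  by rewrite divr_ge0 ?mulr_ge0 ?exprn_ge0 ?sqrtr_ge0.
pose inner (m : 'I_M) : 'I_M.+2 := lift ord0 (widen_ord (leqnSn M) m).
have rev_inner m : rev_ord (inner m) = (rev_ord m).+1 :> nat.
  by rewrite /= /bump leq0n; have := ltn_ord m; lia.
apply: (@le_trans _ _ (\sum_(m < M) (B * (2 * ((m.*2.+3%:R ^+ 2)^-1
    + ((rev_ord m).*2.+3%:R ^+ 2)^-1)))%:C%C)).
  apply: ler_sum => m _; have dist_ge3 : (3 <= odd_dist (inner m))%N.
    by rewrite /odd_dist rev_inner leq_min.
  apply: le_trans (norm_pole_term_le dist_ge3 w_ge wX_le2 Nw_ge) _.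
  rewrite lecR ler_wpM2l // ler_pM2l //; have := inv_sqr_odd_dist_le (R := R) (inner m).
  by rewrite rev_inner.
rewrite -rmorph_sum lecR -mulr_sumr -[leRHS]mulr1 ler_wpM2l //.
rewrite -mulr_sumr big_split /= [X in _ + X](_ : _ = \sum_(m < M) (m.*2.+3%:R ^+ 2)^-1).
  by have := @sum_inv_odd_sqr R M; lra.
by rewrite [RHS](reindex_inj rev_ord_inj).
Qed.

End other_poles_bound.

Section dominant_poles.
Context {R : realType}.
Implicit Types (k : nat) (u : R).

Lemma sum_pole_term_ends k u M :
  ((descent_poly R k).[- expR u] / (1 + expR u) ^+ k.+1)%:C%C =
  2 * (complex.Re (pole_term k M.+2 u pi))%:C%C
  + \sum_(m < M) pole_term k M.+2 u (odd_pi m.+1).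
Proof.
have last_term : pole_term k M.+2 u (odd_pi M.+1) = conjc (pole_term k M.+2 u pi).
  by have := pole_term_rev_ord k u (@ord0 M.+1); rewrite odd_pi0 /= subn1.
rewrite (@sum_pole_term _ _ M.+2) // big_ord_recl big_ord_recr odd_pi0 /= last_term.
by rewrite [X in _ + X]addrC addrA addcJ.
Qed.

Lemma norm_sub_pole_term_le k u N : (1 < N)%N ->
  8 / 9 <= expR (u / N%:R) -> expR (u / N%:R) ^+ k.+1 <= 2 ->
  u ^+ 2 - 1 <= (N%:R * (1 - expR (u / N%:R))) ^+ 2 ->
  `|(descent_poly R k.+1).[- expR u] / (1 + expR u) ^+ k.+2 -
    2 * complex.Re (pole_term k.+1 N u pi)| <=
  2 * k.+1`!%:R / gap_radius u ^+ k.
Proof.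
case: N => [|[|M]] // _ w_ge wX_le Nw_ge.
have := norm_sum_other_poles_le w_ge wX_le Nw_ge.
rewrite -[\sum_(m < M) _](addKr (2 * (complex.Re (pole_term k.+1 M.+2 u pi))%:C%C)).
rewrite -sum_pole_term_ends addrC -(rmorph_nat (real_complex R) 2) -rmorphM -rmorphB.
by rewrite normc_def /= expr0n addr0 sqrtr_sqr lecR.
Qed.

(* Each of the poles [+- i pi] contributes [Re (n! / (- (u + i pi))^(n+1))]. *)
Lemma descent_poly_dominant_poles k u :
  `|(descent_poly R k.+1).[- expR u] / (1 + expR u) ^+ k.+2 -
    2 * complex.Re (k.+1`!%:R / (- Complex u pi) ^+ k.+2)| <=
  2 * k.+1`!%:R / gap_radius u ^+ k.
Proof.
have upi_neq0 : Complex u (@pi R) != 0.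
  by rewrite eq_complex negb_and /= orbC gt_eqF ?pi_gt0.
have w_cvg := @cvg_expR_divn R u.
have wX_cvg : expR (u / N%:R) ^+ k.+1 @[N --> \oo] --> (1 : R).
  by rewrite -[X in _ --> X](expr1n _ k.+1); exact: cvgX.
have Nw_cvg : (N%:R * (1 - expR (u / N%:R))) ^+ 2 @[N --> \oo] --> u ^+ 2.
  have dexp := cvg_difference_quotient (c := u) (is_derive_expR 0).
  rewrite expR0 mulr1 in dexp; under eq_fun do rewrite -sqrrN -mulrN opprB.
  exact: cvgX.
have error_cvg : `|(descent_poly R k.+1).[- expR u] / (1 + expR u) ^+ k.+2 -
      2 * complex.Re (pole_term k.+1 N u pi)| @[N --> \oo] -->
    `|(descent_poly R k.+1).[- expR u] / (1 + expR u) ^+ k.+2 -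
      2 * complex.Re (k.+1`!%:R / (- Complex u pi) ^+ k.+2)|.
  apply: cvg_norm; apply: cvgB; first exact: cvg_cst.
  apply: cvgM; first exact: cvg_cst.
  by apply: cvg_complex_Re; exact: cvg_pole_term.
apply: (cvgr_to_le error_cvg).
near=> N; apply: norm_sub_pole_term_le; near: N.
- by exists 2%N.
- by apply: (cvgr_ge (1 : R)) => //; lra.
- by apply: (cvgr_le (1 : R)) => //; lra.
- by apply: (cvgr_ge (u ^+ 2)) => //; lra.
Unshelve. all: by end_near. Qed.

End dominant_poles.

(** * Alternation of signs and roots *)

Section pi_cot.
Context {R : realType}.
Implicit Types (n j : nat) (x y theta : R).

Definition pi_cot theta : R := pi * cos theta / sin theta.

Lemma pi_cotE theta : pi_cot theta = pi * tan (pi / 2 - theta).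
Proof.
have -> : pi / 2 - theta = - (theta - pi / 2) by ring.
by rewrite /pi_cot /tan sinN cosN sinBpihalf cosBpihalf opprK mulrA.
Qed.

Lemma pi_cotK x : pi_cot (pi / 2 - atan (x / pi)) = x.
Proof. by rewrite pi_cotE subKr atanK mulrC divfK // gt_eqF // pi_gt0. Qed.

Lemma pi_cot_lt x y : 0 < x -> x < y -> y < pi -> pi_cot y < pi_cot x.
Proof.
move=> x_gt0 xy y_lt; rewrite !pi_cotE ltr_pM2l ?pi_gt0 // ltr_tan.
- by rewrite ltrD2l ltrN2.
- by rewrite in_itv /=; apply/andP; split; lra.
- by rewrite in_itv /=; apply/andP; split; lra.
Qed.

Lemma pi_cot_le x y : 0 < x -> x <= y -> y < pi -> pi_cot y <= pi_cot x.
Proof.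
by move=> x_gt0; rewrite le_eqVlt => /predU1P[->//|xy] y_lt; rewrite ltW ?pi_cot_lt.
Qed.

Lemma sqr_pi_cotD theta : sin theta != 0 ->
  pi_cot theta ^+ 2 + pi ^+ 2 = (pi / sin theta) ^+ 2.
Proof.
move=> sin_neq0; rewrite /pi_cot; transitivity
  (pi ^+ 2 * (cos theta ^+ 2 + sin theta ^+ 2) / sin theta ^+ 2); first by field.
by rewrite cos2Dsin2 mulr1 expr_div_n.
Qed.

Lemma Complex_pi_cot theta : sin theta != 0 ->
  Complex (pi_cot theta) pi = (pi / sin theta)%:C%C * cis theta.
Proof.
move=> sin_neq0; apply/eqP; rewrite eq_complex /pi_cot /= !mul0r subr0 addr0.
by rewrite divfK // eqxx andbT; apply/eqP; field.
Qed.

Lemma Re_dominant_pole n j theta : sin theta != 0 -> n.+1%:R * theta = j%:R * pi ->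
  complex.Re (n`!%:R / (- Complex (pi_cot theta) pi) ^+ n.+1) =
  (-1) ^+ (n.+1 + j) * (n`!%:R / (pi / sin theta) ^+ n.+1).
Proof.
move=> sin_neq0 theta_eq.
have -> : (- Complex (pi_cot theta) pi) ^+ n.+1 =
    ((-1) ^+ (n.+1 + j) * (pi / sin theta) ^+ n.+1)%:C%C.
  rewrite Complex_pi_cot // [LHS]exprNn [X in _ * X]exprMn cisX theta_eq cis_natpi.
  by rewrite [RHS]rmorphM rmorph_sign [in RHS]rmorphXn exprD mulrA mulrAC.
rewrite -(rmorph_nat (real_complex R)) -fmorphV -rmorphM /=.
by rewrite invfM invr_sign mulrCA.
Qed.

End pi_cot.

Section sign_alternation.
Context {R : realType}.
Implicit Types delta : R.

Lemma expr_add2_lt (r rho q : R) k :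
  0 < r -> 0 < rho -> r * rho <= q -> rho ^+ 2 < r ^+ k -> rho ^+ k.+2 < q ^+ k.
Proof.
move=> r_gt0 rho_gt0 q_ge rho2_lt; have rrho_gt0 : 0 < r * rho by rewrite mulr_gt0.
apply: (@lt_le_trans _ _ ((r * rho) ^+ k)).
  by rewrite exprMn -[k.+2]addn2 exprD mulrC ltr_pM2r ?exprn_gt0.
by rewrite lerXn2r ?nnegrE // ?(le_trans _ q_ge) // ltW.
Qed.

(* [rho] is the distance from [u] to the dominant poles [+- i pi]. *)
Lemma other_poles_negligible delta : 0 < delta -> \forall k \near \oo,
  forall u rho : R, 0 < rho -> u ^+ 2 + pi ^+ 2 = rho ^+ 2 -> delta * rho <= pi ->
  rho ^+ k.+2 < gap_radius u ^+ k.
Proof.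
move=> delta_gt0; pose r : R := Num.sqrt (1 + delta ^+ 2 / 2).
have delta2_gt0 : 0 < delta ^+ 2 by rewrite exprn_gt0.
have r2E : r ^+ 2 = 1 + delta ^+ 2 / 2 by rewrite sqr_sqrtr //; lra.
have r_gt1 : 1 < r by rewrite -sqrtr1 ltr_sqrt; lra.
have r_gt0 : 0 < r := lt_trans ltr01 r_gt1.
have invr_cvg : r^-1 ^+ k @[k --> \oo] --> 0.
  by apply: cvg_expr; rewrite gtr0_norm ?invr_gt0 // invf_lt1.
have bound_gt0 : 0 < (pi / delta) ^+ 2 by rewrite exprn_gt0 // divr_gt0 // pi_gt0.
near=> k => u rho rho_gt0 rho2E delta_rho.
have delta_rho2 : delta ^+ 2 * rho ^+ 2 <= pi ^+ 2.
  by rewrite -exprMn lerXn2r ?nnegrE ?pi_ge0 // mulr_ge0 // ltW.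
apply: (expr_add2_lt r_gt0 rho_gt0).
  rewrite -(ler_pXn2r (n := 2)) ?nnegrE ?sqrtr_ge0 ?mulr_ge0 ?(ltW r_gt0) ?(ltW rho_gt0) //.
  by rewrite exprMn r2E sqr_gap_radius; lra.
apply: (@le_lt_trans _ _ ((pi / delta) ^+ 2)).
  by rewrite expr_div_n ler_pdivlMr // mulrC.
have : r^-1 ^+ k < ((pi / delta) ^+ 2)^-1.
  by near: k; apply: (cvgr_lt (0 : R)); rewrite // invr_gt0.
by rewrite exprVn ltf_pV2 ?posrE // exprn_gt0.
Unshelve. all: by end_near. Qed.

Lemma descent_poly_sign delta : 0 < delta -> \forall k \near \oo,
  forall j theta, delta <= sin theta -> k.+2%:R * theta = j%:R * pi ->
  0 < (-1) ^+ (k.+2 + j) * (descent_poly R k.+1).[- expR (pi_cot theta)].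
Proof.
move=> delta_gt0; near=> k => j theta delta_le theta_eq.
have sin_gt0 := lt_le_trans delta_gt0 delta_le.
have rho_gt0 : 0 < pi / sin theta by rewrite divr_gt0 // pi_gt0.
have := descent_poly_dominant_poles k (pi_cot theta).
rewrite (Re_dominant_pole _ theta_eq) ?gt_eqF //.
set L := _ / (pi / _) ^+ _; set P := _.[_]; set D := (1 + _) ^+ _.
have lt_L : 2 * k.+1`!%:R / gap_radius (pi_cot theta) ^+ k < 2 * L.
  rewrite -mulrA ltr_pM2l // ltr_pM2l ?ltr0n ?fact_gt0 // ltf_pV2 ?posrE.
  - have : delta * (pi / sin theta) <= pi.
      by rewrite mulrCA ger_pMr ?pi_gt0 // ler_pdivrMr // mul1r.
    have : pi_cot theta ^+ 2 + pi ^+ 2 = (pi / sin theta) ^+ 2.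
      by rewrite sqr_pi_cotD ?gt_eqF.
    move: (pi_cot theta) (pi / sin theta) rho_gt0.
    by near: k; exact: other_poles_negligible.
  - by rewrite exprn_gt0 // gap_radius_gt0.
  - by rewrite exprn_gt0.
have D_gt0 : 0 < D by rewrite exprn_gt0 // addr_gt0 // expR_gt0.
move=> /le_lt_trans/(_ lt_L); rewrite ltr_distl => /andP[lower upper].
suff : 0 < (-1) ^+ (k.+2 + j) * (P / D) by rewrite mulrA pmulr_lgt0 ?invr_gt0.
by move: lower upper; rewrite -signr_odd; case: (odd _); rewrite ?expr1 ?expr0; lra.
Unshelve. all: by end_near. Qed.

End sign_alternation.

Section root_count.
Context {R : realType}.
Implicit Types (n : nat) (a b s t : R).

Definition grid_angle n j : R := j%:R * pi / n.+1%:R.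

Lemma grid_angle_lt n i j : (i < j)%N -> grid_angle n i < grid_angle n j.
Proof.
by move=> ij; rewrite /grid_angle -!mulrA ltr_pM2r ?ltr_nat // divr_gt0 ?pi_gt0.
Qed.

Lemma sin_lower_bound_segment a b : 0 < a -> b < pi ->
  exists2 delta, 0 < delta & forall theta, a <= theta <= b -> delta <= sin theta.
Proof.
move=> a_gt0 b_lt; have [ab|ba] := leP a b; last first.
  by exists 1 => // theta /andP[/le_trans/[apply]]; rewrite leNgt ba.
have [|c cI sin_min] := @EVT_min R sin a b ab.
  by apply: continuous_subspaceT => x; exact: continuous_sin.
exists (sin c) => [|theta thetaI]; last by apply: sin_min; rewrite in_itv.
move: cI; rewrite in_itv /= => /andP[ac cb].
by apply: sin_gt0_pi; rewrite (lt_le_trans a_gt0 ac) (le_lt_trans cb b_lt).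
Qed.

Lemma descent_poly_root_between a b : 0 < a -> b < pi -> \forall k \near \oo,
  forall j, a <= grid_angle k.+1 j -> grid_angle k.+1 j.+1 <= b ->
  exists2 z, root (descent_poly R k.+1) z &
    expR (pi_cot (grid_angle k.+1 j.+1)) < - z < expR (pi_cot (grid_angle k.+1 j)).
Proof.
move=> a_gt0 b_lt; have [delta delta_gt0 sin_ge] := sin_lower_bound_segment a_gt0 b_lt.
near=> k => j; have := grid_angle_lt k.+1 (ltnSn j).
set x := grid_angle _ j; set y := grid_angle _ j.+1 => xy ax yb.
have angleE i : k.+2%:R * grid_angle k.+1 i = i%:R * pi by rewrite mulrC divfK.
have sign i theta : delta <= sin theta -> k.+2%:R * theta = i%:R * pi ->
    0 < (-1) ^+ (k.+2 + i) * (descent_poly R k.+1).[- expR (pi_cot theta)].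
  by move: i theta; near: k; exact: descent_poly_sign.
have x_ge : delta <= sin x by apply: sin_ge; rewrite ax (le_trans (ltW xy)).
have y_ge : delta <= sin y by apply: sin_ge; rewrite yb (le_trans ax) ?ltW.
have := sign _ _ x_ge (angleE j); have := sign _ _ y_ge (angleE j.+1).
have cot_lt : pi_cot y < pi_cot x.
  by rewrite pi_cot_lt // ?(lt_le_trans a_gt0) // (le_lt_trans yb).
rewrite addnS exprS mulN1r mulNr oppr_gt0 => y_sign x_sign.
have [||z zI rz] := @polyrcf.poly_ivtoo R (descent_poly R k.+1)
    (- expR (pi_cot x)) (- expR (pi_cot y)).
- by rewrite lerN2 ler_expR ltW.
- move: y_sign x_sign; rewrite -signr_odd; move: (_.[_]) (_.[_]) => p q.
  by case: (odd _); rewrite ?expr1 ?expr0 ?mulN1r ?mul1r; nra.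
- by exists z => //; move: zI; rewrite in_itv /= ltrNl ltrNr andbC.
Unshelve. all: by end_near. Qed.

Lemma leq_card_separated (T : finType) {d} {K : porderType d} (y : T -> K)
    (v : nat -> K) n :
  (forall i, (i < n)%N -> exists k, (v i.+1 < y k < v i)%O) ->
  (n <= #|[set k | (v n < y k < v 0%N)%O]%SET|)%N.
Proof.
move=> sep; suff [//] : (n <= #|[set k | (v n < y k < v 0%N)%O]%SET|)%N /\ (v n <= v 0%N)%O.
elim: n sep => [//|n IH] sep; have [k /andP[k_gt k_lt]] := sep _ (ltnSn n).
have [card_ge v_le] := IH (fun i lt_in => sep i (ltnW lt_in)).
have v_lt : (v n.+1 < v n)%O := lt_trans k_gt k_lt.
split; last exact: le_trans (ltW v_lt) v_le.
have k_new : k \notin [set k | (v n < y k < v 0%N)%O]%SET by rewrite inE (lt_gtF k_lt).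
apply: (@leq_trans #|k |: [set k | (v n < y k < v 0%N)%O]%SET|).
  by rewrite cardsU1 k_new add1n ltnS.
apply: subset_leq_card; apply/fintype.subsetP => i; rewrite !inE.
case/predU1P => [->|/andP[i_gt ->]]; first by rewrite k_gt (lt_le_trans k_lt).
by rewrite (lt_trans v_lt).
Qed.

Lemma grid_angle_segment n a b : 0 < a -> a <= b ->
  exists i m : nat, n.+1%:R * ((b - a) / pi) - 2 <= m%:R /\
    forall j, (j < m)%N -> a <= grid_angle n (i + j) /\ grid_angle n (i + j).+1 <= b.
Proof.
move=> a_gt0 ab; have b_gt0 := lt_le_trans a_gt0 ab; have pi_gt0 := @pi_gt0 R.
pose A := n.+1%:R * a / pi; pose B := n.+1%:R * b / pi.
have /truncn_itv/andP[A_ge A_lt] : 0 <= A by rewrite !mulr_ge0 ?invr_ge0 ?ltW.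
have /truncn_itv/andP[B_ge B_lt] : 0 <= B by rewrite !mulr_ge0 ?invr_ge0 ?ltW.
exists (Num.trunc A).+1, (Num.trunc B - (Num.trunc A).+1)%N; split.
  have : (Num.trunc B)%:R <=
      (Num.trunc B - (Num.trunc A).+1)%:R + (Num.trunc A).+1%:R :> R.
    by rewrite -natrD ler_nat addnC -leq_subLR.
  rewrite mulrBl mulrBr !mulrA -/A -/B -[(Num.trunc A).+1%:R]natr1.
  by rewrite -natr1 in B_lt; lra.
move=> j; rewrite ltn_subRL => j_lt.
split; rewrite /grid_angle.
  rewrite ler_pdivlMr // -ler_pdivrMr // [a * _]mulrC (le_trans (ltW A_lt)) //.
  by rewrite ler_nat leq_addr.
rewrite ler_pdivrMr // -ler_pdivlMr // [b * _]mulrC (le_trans _ B_ge) //.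
by rewrite ler_nat.
Qed.

Lemma eulerian_root_count_angles a b : 0 < a -> a <= b -> b < pi ->
  \forall n \near \oo, forall y : nat -> R, eulerian_roots n.+1 y ->
  n.+1%:R * ((b - a) / pi) - 2 <=
  #|[set k : 'I_n.+1 | expR (pi_cot b) < - y k.+1 < expR (pi_cot a)]%SET|%:R.
Proof.
move=> a_gt0 ab b_lt; near=> n => y roots.
have [i [m [m_ge angleI]]] := grid_angle_segment n.+1 a_gt0 ab.
apply: (@le_trans _ _ m%:R).
  apply: le_trans m_ge; rewrite lerD2r ler_wpM2r ?ler_nat //.
  by rewrite divr_ge0 ?pi_ge0 ?subr_ge0.
case: m angleI {m_ge} => [//|m] angleI; rewrite ler_nat.
pose v j := expR (pi_cot (grid_angle n.+1 (i + j))).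
have root_between j : (j < m.+1)%N -> exists k : 'I_n.+1, v j.+1 < - y k.+1 < v j.
  move=> /angleI[a_le le_b]; have [z rz zI] : exists2 z, root (descent_poly R n.+1) z &
      v j.+1 < - z < v j.
    rewrite /v addnS; move: (i + j)%N a_le le_b {angleI v}.
    by near: n; exact: descent_poly_root_between.
  move: rz; rewrite -eulerian_polyE => /(eulerian_rootsP roots)[[//|k] kn zE].
  by exists (Ordinal (kn : k < n.+1)%N); rewrite /= -zE.
apply: leq_trans (leq_card_separated root_between) _.
apply: subset_leq_card; apply/fintype.subsetP => k; rewrite !inE => /andP[k_gt k_lt].
have [a_le _] := angleI 0%N isT; have [am_le le_b] := angleI m (ltnSn m).
apply/andP; split.
  apply: le_lt_trans k_gt; rewrite /v addnS ler_expR pi_cot_le //.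
  by rewrite (lt_le_trans a_gt0) // (le_trans am_le) // ltW // grid_angle_lt.
apply: lt_le_trans k_lt _; rewrite ler_expR pi_cot_le //.
apply: (le_lt_trans _ b_lt); apply: le_trans le_b; rewrite ltW // grid_angle_lt //.
by rewrite addn0 ltnS leq_addr.
Unshelve. all: by end_near. Qed.

Definition eulerian_cdf t : R := 1 / 2 + atan (ln t / pi) / pi.

Lemma eulerian_root_count s t : 0 < s -> s < t -> \forall n \near \oo,
  forall y : nat -> R, eulerian_roots n.+1 y ->
  n.+1%:R * (eulerian_cdf t - eulerian_cdf s) - 2 <=
  #|[set k : 'I_n.+1 | s < - y k.+1 <= t]%SET|%:R.
Proof.
move=> s_gt0 st; have t_gt0 := lt_trans s_gt0 st.
pose a x : R := pi / 2 - atan (ln x / pi).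
have a_gt0 x : 0 < a x by have := atan_ltpi2 (ln x / pi); rewrite /a; lra.
have a_lt x : a x < pi by have := atan_gtNpi2 (ln x / pi); rewrite /a; lra.
have a_le : a t <= a s.
  by rewrite lerD2l lerN2 le_atan // ler_pM2r ?invr_gt0 ?pi_gt0 // ler_ln // ltW.
near=> n => y roots.
have -> : eulerian_cdf t - eulerian_cdf s = (a s - a t) / pi.
  by rewrite /eulerian_cdf /a; ring.
apply: (@le_trans _ _ #|[set k : 'I_n.+1 |
    expR (pi_cot (a s)) < - y k.+1 < expR (pi_cot (a t))]%SET|%:R).
  by move: y roots; near: n; exact: eulerian_root_count_angles.
rewrite !pi_cotK !lnK // ler_nat; apply: subset_leq_card.
by apply/fintype.subsetP => k; rewrite !inE => /andP[-> /ltW].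
Unshelve. all: by end_near. Qed.

End root_count.

(** * The limit law *)

Section tail_integral.
Context {R : realType}.

Lemma cvgy_ln : ln x @[x --> +oo] --> (+oo : set_system R).
Proof.
apply/cvgryPge => y; near=> x; rewrite -ler_expR lnK.
  by near: x; exact: nbhs_pinfty_ge.
by rewrite posrE; near: x; exact: nbhs_pinfty_gt.
Unshelve. all: by end_near. Qed.

Lemma integral_itvoy_density (f F : R -> R) (r l : R) :
  (forall x, r <= x -> 0 <= f x) -> (forall x, r <= x -> {for x, continuous f}) ->
  (forall x, r <= x -> is_derive x 1 F (f x)) -> F x @[x --> +oo] --> l ->
  (\int[lebesgue_measure]_(x in `]r, +oo[) (f x)%:E = (l - F r)%:E)%E.
Proof.
move=> f_ge0 f_cont dF F_cvg.
have in_cont : {within `[r, +oo[, continuous f}.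
  by apply: continuous_in_subspaceT => x; rewrite inE /= in_itv /= andbT => /f_cont.
rewrite integral_itv_obnd_cbnd; last first.
  apply/measurable_EFinP; apply: (@measurable_funS _ _ _ _ `[r, +oo[%classic) => //.
    by apply: subset_itvr; rewrite bnd_simp.
  exact: subspace_continuous_measurable_fun.
rewrite (ge0_continuous_FTC2y f_ge0 in_cont F_cvg) //.
- by move=> x rx; have [] := dF x (ltW rx).
- apply: cvg_at_right_filter; apply: differentiable_continuous; apply/derivable1_diffP.
  by have [] := dF r (lexx r).
- by move=> x; rewrite in_itv /= andbT derive1E => /ltW/dF[].
Qed.

Lemma eq_probability_itvoy (P Q : probability R R) :
  (forall r, P `]r, +oo[%classic = Q `]r, +oo[%classic) ->
  forall A, measurable A -> P A = Q A.
Proof.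
move=> PQ; apply: (measure_unique (@RGenOInfty.G R) (fun n => `](- n%:R), +oo[%classic)).
- exact: RGenOInfty.measurableE.
- move=> _ _ [a ->] [b ->]; exists (Num.max a b).
  by apply/seteqP; split => x /=; rewrite !in_itv /= !andbT gt_max => /andP.
- by move=> n; exists (- n%:R).
- rewrite -subTset => x _; exists (Num.bound `|x|) => //=.
  by rewrite in_itv /= andbT ltrNl (le_lt_trans (ler_norm _)) // normrN archi_boundP.
- by move=> _ [r ->]; exact: PQ.
- by move=> n; rewrite (le_lt_trans (probability_le1 _ _)) ?ltry.
Qed.

End tail_integral.

Section eulerian_law.
Context {R : realType}.
Implicit Types (s t : R).

Lemma cvgy_eulerian_cdf : eulerian_cdf x @[x --> +oo] --> (1 : R).
Proof.
rewrite [X in _ --> X](_ : 1 = 1 / 2 + pi / 2 / pi); last first.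
  by rewrite mulrAC divff ?gt_eqF ?pi_gt0 // -splitr.
rewrite /eulerian_cdf; apply: cvgD; first exact: cvg_cst.
apply: cvgM; last exact: cvg_cst.
apply: (cvg_comp (fun x => ln x / pi) atan); last exact: cvgy_atan.
by apply: gt0_cvgMly; [rewrite invr_gt0 pi_gt0|exact: cvgy_ln].
Qed.

Lemma eulerian_cdfV t : 0 < t -> eulerian_cdf t^-1 = 1 - eulerian_cdf t.
Proof. by move=> t_gt0; rewrite /eulerian_cdf lnV // mulNr atanN mulNr; lra. Qed.

Lemma lt_eulerian_cdf s t : 0 < s -> s < t -> eulerian_cdf s < eulerian_cdf t.
Proof.
move=> s_gt0 st; rewrite ltrD2l ltr_pM2r ?invr_gt0 ?pi_gt0 // lt_atan //.
by rewrite ltr_pM2r ?invr_gt0 ?pi_gt0 // ltr_ln ?posrE // (lt_trans s_gt0).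
Qed.

Definition eulerian_density t : R :=
  if 0 < t then (t * (ln t ^+ 2 + pi ^+ 2))^-1 else 0.

Lemma eulerian_density_denominator_gt0 t : 0 < t -> 0 < t * (ln t ^+ 2 + pi ^+ 2).
Proof. by move=> t_gt0; rewrite mulr_gt0 // ltr_wpDl ?sqr_ge0 // exprn_gt0 // pi_gt0. Qed.

Lemma eulerian_density_ge0 t : 0 <= eulerian_density t.
Proof.
rewrite /eulerian_density; case: ifP => // t_gt0.
by rewrite invr_ge0 ltW // eulerian_density_denominator_gt0.
Qed.

Lemma continuous_eulerian_density t : 0 < t -> {for t, continuous eulerian_density}.
Proof.
move=> t_gt0; rewrite /prop_for /continuous_at /eulerian_density t_gt0.
have : (x * (ln x ^+ 2 + pi ^+ 2))^-1 @[x --> t] --> (t * (ln t ^+ 2 + pi ^+ 2))^-1.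
  apply: cvgV; first by rewrite gt_eqF // eulerian_density_denominator_gt0.
  apply: cvgM; first exact: cvg_id.
  apply: cvgD; last exact: cvg_cst.
  by apply: cvgX; exact: continuous_ln.
apply: cvg_trans; apply: near_eq_cvg; near=> x.
by rewrite ifT //; near: x; exact: lt_nbhsr.
Unshelve. all: by end_near. Qed.

Lemma measurable_eulerian_density : measurable_fun setT eulerian_density.
Proof.
have -> : eulerian_density = eulerian_density \_ `]0, +oo[.
  apply/funext => t; rewrite patchE mem_setE in_itv /= andbT /eulerian_density.
  by case: ifP.
apply/(measurable_restrictT _ _).1 => //; apply: open_continuous_measurable_fun => //.
by move=> t; rewrite inE /= in_itv /= andbT; exact: continuous_eulerian_density.
Qed.

Lemma is_derive_eulerian_cdf t :
  0 < t -> is_derive t 1 eulerian_cdf (eulerian_density t).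
Proof.
move=> t_gt0.
have d_ln : is_derive t 1 (fun x => ln x / pi) (t^-1 / pi).
  have -> : (fun x => ln x / pi) = pi^-1 \*: (@ln R) by apply/funext => x; rewrite /= mulrC.
  by rewrite [_ / _]mulrC; apply: is_deriveZ; exact: is_derive1_ln.
have -> : @eulerian_cdf R = (fun x => 1 / 2 + pi^-1 * atan (ln x / pi)).
  by apply/funext => x; rewrite /eulerian_cdf [pi^-1 * _]mulrC.
have := @is_derive1_comp _ atan (fun x => ln x / pi) t _ _ (is_derive1_atan _) d_ln.
move=> /(is_deriveZ pi^-1)/(is_deriveD (is_derive_cst (1 / 2 : R) t 1)) d_cdf.
suff -> : eulerian_density t =
    0 + pi^-1 *: ((1 + (ln t / pi) ^+ 2)^-1 * (t^-1 / pi)) by exact: d_cdf.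
rewrite add0r /eulerian_density t_gt0 {d_cdf}.
have pi_neq0 : pi != 0 :> R by rewrite gt_eqF // pi_gt0.
have q_neq0 : ln t ^+ 2 + pi ^+ 2 != 0.
  by rewrite gt_eqF // ltr_wpDl ?sqr_ge0 // exprn_gt0 // pi_gt0.
have -> : 1 + (ln t / pi) ^+ 2 = (ln t ^+ 2 + pi ^+ 2) / pi ^+ 2.
  by rewrite mulrDl divff ?expf_neq0 // expr_div_n addrC.
rewrite -[RHS]/(_ * _).
move: (ln t ^+ 2 + pi ^+ 2) (pi : R) q_neq0 pi_neq0 => q p q_neq0 p_neq0.
by field; rewrite q_neq0 p_neq0 gt_eqF.
Qed.

Definition eulerian_law (A : set R) : \bar R :=
  (\int[lebesgue_measure]_(x in A) (eulerian_density x)%:E)%E.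

Let eulerian_law0 : eulerian_law set0 = 0%E.
Proof. by rewrite /eulerian_law integral_set0. Qed.

Let eulerian_law_ge0 A : (0 <= eulerian_law A)%E.
Proof. by apply: integral_ge0 => x _; rewrite lee_fin eulerian_density_ge0. Qed.

Let eulerian_law_sigma_additive : semi_sigma_additive eulerian_law.
Proof.
move=> /= F mF tF mUF; rewrite /eulerian_law; apply: cvg_toP.
  apply: ereal_nondecreasing_is_cvgn => m n mn.
  by apply: lee_sum_nneg_natr => // k _ _; exact: eulerian_law_ge0.
rewrite ge0_integral_bigcup //=.
- by apply/measurable_EFinP; apply: measurable_funTS; exact: measurable_eulerian_density.
- by move=> x _; rewrite lee_fin eulerian_density_ge0.
Qed.

HB.instance Definition _ := isMeasure.Build _ _ _
  eulerian_law eulerian_law0 eulerian_law_ge0 eulerian_law_sigma_additive.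

Lemma eulerian_law_itvoy t :
  0 < t -> eulerian_law `]t, +oo[%classic = (1 - eulerian_cdf t)%:E.
Proof.
move=> t_gt0; apply: integral_itvoy_density => [x _|x tx|x tx|].
- exact: eulerian_density_ge0.
- by apply: continuous_eulerian_density; exact: lt_le_trans tx.
- by apply: is_derive_eulerian_cdf; exact: lt_le_trans tx.
- exact: cvgy_eulerian_cdf.
Qed.

Lemma eulerian_law_itv0y : eulerian_law `]0, +oo[%classic = 1%E.
Proof.
have itv0yE : \bigcup_n `](n.+1%:R^-1), +oo[%classic = `]0, +oo[%classic :> set R.
  apply/seteqP; split => [x [n _]|x] /=; rewrite !in_itv /= !andbT.
    by apply: le_lt_trans; rewrite invr_ge0.
  move=> /ltr_add_invr[n]; rewrite add0r => n_lt.
  by exists n => //=; rewrite in_itv /= n_lt.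
have to_law : eulerian_law `](n.+1%:R^-1), +oo[%classic @[n --> \oo] -->
    eulerian_law `]0, +oo[%classic.
  rewrite -itv0yE; apply: nondecreasing_cvg_mu; rewrite ?itv0yE //.
  move=> m n mn; apply/subsetPset; apply: subset_itvr.
  by rewrite bnd_simp lef_pV2 ?posrE // ler_nat ltnS.
have to_one : eulerian_law `](n.+1%:R^-1), +oo[%classic @[n --> \oo] --> 1%E.
  under eq_fun do rewrite eulerian_law_itvoy ?invr_gt0 // eulerian_cdfV // subKr.
  apply: cvg_EFin; first by near=> n.
  have := cvg_comp _ _ cvgr_idn cvgy_eulerian_cdf.
  by rewrite -cvg_shiftS.
exact: cvg_unique to_law to_one.
Unshelve. all: by end_near. Qed.

Lemma eulerian_law_setI_pos A : measurable A ->
  eulerian_law A = eulerian_law (A `&` `]0, +oo[).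
Proof.
move=> mA; rewrite /eulerian_law integral_mkcondr; apply: eq_integral => x _.
by rewrite patchE mem_setE in_itv /= andbT /eulerian_density; case: ifP.
Qed.

Let eulerian_law_setT : eulerian_law setT = 1%E.
Proof. by rewrite eulerian_law_setI_pos // setTI eulerian_law_itv0y. Qed.

HB.instance Definition _ :=
  Measure_isProbability.Build _ _ R eulerian_law eulerian_law_setT.

Lemma eulerian_law_itvoc s t : 0 < s -> s <= t ->
  eulerian_law `]s, t]%classic = (eulerian_cdf t - eulerian_cdf s)%:E.
Proof.
move=> s_gt0 st; have t_gt0 := lt_le_trans s_gt0 st.
have -> : `]s, t]%classic = `]s, +oo[ `\` `]t, +oo[ :> set R.
  apply/seteqP; split => x /=; rewrite !in_itv /= !andbT leNgt.
    by move=> /andP[-> /negP].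
  by move=> [-> /negP].
have le_st : `]t, +oo[%classic `<=` `]s, +oo[%classic by exact: subset_itvr.
rewrite [LHS]measureD //; last by rewrite (le_lt_trans (probability_le1 _ _)) ?ltry.
rewrite setIidr // [X in (X - _)%E](eulerian_law_itvoy s_gt0).
by rewrite [X in (_ - X)%E](eulerian_law_itvoy t_gt0) -EFinB; congr (_%:E); ring.
Qed.

Lemma support_eulerian_law :
  measure_support (eulerian_law : probability R R) = [set t | 0 <= t].
Proof.
apply/seteqP; split => t /=.
  move=> t_supp; rewrite leNgt; apply/negP => t_lt0.
  have := t_supp `]-oo, 0[%classic (interval_open _ _).
  rewrite /= in_itv /= => /(_ isT isT t_lt0).
  suff -> : eulerian_law `]-oo, 0[%classic = 0%E by rewrite ltxx.
  rewrite eulerian_law_setI_pos // [X in eulerian_law X](_ : _ = set0) ?measure0 //.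
  apply/seteqP; split => // x [] /=; rewrite !in_itv /= andbT => /lt_trans/[apply].
  by rewrite ltxx.
move=> t_ge0 U U_open Ut; have [e /= e_gt0 U_ball] : nbhs t U by exact: open_nbhs_nbhs.
have subU : `](t + e / 4), (t + e / 2)]%classic `<=` U.
  move=> x /=; rewrite in_itv /= => /andP[x_gt x_le]; apply: U_ball => /=.
  by rewrite ltr_norml; apply/andP; split; lra.
apply: (@lt_le_trans _ _ (eulerian_law `](t + e / 4), (t + e / 2)]%classic)).
  rewrite eulerian_law_itvoc; [|lra|lra].
  by rewrite lte_fin subr_gt0 lt_eulerian_cdf; lra.
by apply: le_measure; rewrite ?inE //; exact: open_measurable.
Qed.

Lemma has_density_eulerian_law :
  has_density (eulerian_law : probability R R) eulerian_density.
Proof. by split; [exact: measurable_eulerian_density|exact: eulerian_density_ge0|]. Qed.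

End eulerian_law.

Section cauchy.
Context {R : realType}.

Lemma standard_cauchy_itvoy (r : R) :
  (\int[lebesgue_measure]_(x in `]r, +oo[) (standard_cauchy_pdf x)%:E =
   (1 / 2 - atan r / pi)%:E)%E.
Proof.
have pi_gt0 := @pi_gt0 R.
have den_gt0 x : 0 < pi * (1 + x ^+ 2) :> R by rewrite mulr_gt0 // ltr_wpDr ?sqr_ge0.
have -> : 1 / 2 = pi / 2 / pi :> R by rewrite mulrAC divff ?gt_eqF.
apply: (integral_itvoy_density (F := fun x => atan x / pi)) => [x _|x _|x _|].
- by rewrite invr_ge0 ltW.
- apply: cvgV; first by rewrite gt_eqF.
  apply: cvgM; first exact: cvg_cst.
  by apply: cvgD; [exact: cvg_cst|exact: exprn_continuous].
- have -> : (fun x => atan x / pi) = pi^-1 \*: (@atan R).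
    by apply/funext => y; rewrite /= mulrC.
  by rewrite /standard_cauchy_pdf invfM; apply: is_deriveZ; exact: is_derive1_atan.
- by apply: cvgM; [exact: cvgy_atan|exact: cvg_cst].
Qed.

Lemma distribution_exp_cauchy d (T : measurableType d) (P : probability T R)
    (Z : {RV P >-> R}) A :
  has_density (distribution P Z) (@standard_cauchy_pdf R) -> measurable A ->
  eulerian_law A = distribution P (exp_pi Z) A.
Proof.
move=> [_ _ densityZ]; move: A; apply: eq_probability_itvoy => r.
have pi_gt0 := @pi_gt0 R; have [r_le0|r_gt0] := leP r 0.
  have pos_gt w : r < exp_pi Z w by rewrite (le_lt_trans r_le0) // expR_gt0.
  rewrite [RHS](_ : _ = 1%E); last first.
    rewrite -[RHS](probability_setT P); congr (P _).
    by apply/seteqP; split => // w _ /=; rewrite in_itv /= pos_gt.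
  apply/eqP; rewrite eq_le probability_le1 //= -eulerian_law_itv0y le_measure ?inE //.
  by apply: subset_itvr; rewrite bnd_simp.
have lt_expE w : (r < exp_pi Z w) = (ln r / pi < Z w).
  by rewrite -{1}[r]lnK ?posrE // ltr_expR ltr_pdivrMr // mulrC.
rewrite [RHS](_ : _ = distribution P Z `](ln r / pi), +oo[%classic); last first.
  by congr (P _); apply/seteqP; split => w /=; rewrite !in_itv /= !andbT lt_expE.
rewrite densityZ // standard_cauchy_itvoy [LHS](eulerian_law_itvoy r_gt0).
by congr (_%:E); rewrite /eulerian_cdf; lra.
Qed.

End cauchy.

(** * Weak convergence *)

Section liminf.
Context {R : realType}.
Implicit Types (u v : nat -> R) (l c : R).

(* [l <= liminf u], stated without extended reals. *)
Definition liminf_ge u l := forall e, 0 < e -> \forall n \near \oo, l - e <= u n.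

Lemma liminf_ge0 : liminf_ge (fun=> 0) 0.
Proof. by move=> e e_gt0; apply: nearW => n; rewrite sub0r oppr_le0 ltW. Qed.

Lemma liminf_geD u v l c :
  liminf_ge u l -> liminf_ge v c -> liminf_ge (fun n => u n + v n) (l + c).
Proof.
move=> ul vc e e_gt0; have e2_gt0 : 0 < e / 2 by rewrite divr_gt0.
near=> n; have : l - e / 2 <= u n by near: n; exact: ul.
by have : c - e / 2 <= v n; [near: n; exact: vc|lra].
Unshelve. all: by end_near. Qed.

Lemma liminf_geZ c u l : 0 <= c -> liminf_ge u l -> liminf_ge (fun n => c * u n) (c * l).
Proof.
move=> c_ge0 ul e e_gt0; have c1_gt0 : 0 < c + 1 by rewrite ltr_wpDl.
near=> n; have : l - e / (c + 1) <= u n by near: n; apply: ul; rewrite divr_gt0.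
move=> /(ler_wpM2l c_ge0); apply: le_trans; rewrite mulrBr lerD2l lerN2.
by rewrite mulrCA ger_pMr // ler_pdivrMr // mul1r lerDl.
Unshelve. all: by end_near. Qed.

Lemma liminf_ge_sum (I : Type) (r : seq I) (u : I -> nat -> R) (l : I -> R) :
  (forall i, liminf_ge (u i) (l i)) ->
  liminf_ge (fun n => \sum_(i <- r) u i n) (\sum_(i <- r) l i).
Proof.
move=> ul; elim: r => [|i r IH].
  by rewrite big_nil; under eq_fun do rewrite big_nil; exact: liminf_ge0.
by rewrite big_cons; under eq_fun do rewrite big_cons; exact: liminf_geD.
Qed.

End liminf.

Section lower_step.
Context {R : realType}.
Implicit Types (g : R -> R) (x y : R) (k i j : nat).

Definition grid k i : R := i%:R / k.+1%:R - k.+1%:R.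

Lemma le_grid k i j : (i <= j)%N -> grid k i <= grid k j.
Proof. by move=> ij; rewrite lerD2r ler_pM2r ?invr_gt0 // ler_nat. Qed.

Lemma gridS k i : grid k i.+1 = grid k i + k.+1%:R^-1.
Proof. by rewrite /grid -natr1 mulrDl mul1r addrAC. Qed.

Lemma grid_last k : grid k (2 * k.+1 ^ 2) = k.+1%:R.
Proof. by rewrite /grid natrM natrX; field. Qed.

Definition cell k i : set R := `]grid k i, grid k i.+1]%classic.

Lemma measurable_cell k i : measurable (cell k i).
Proof. exact: measurable_itv. Qed.
#[local] Hint Resolve measurable_cell : core.

Lemma cell_inj k i j x : cell k i x -> cell k j x -> i = j.
Proof.
wlog ij : i j / (i < j)%N => [cell_inj_lt|].
  case: (ltngtP i j) => // [/cell_inj_lt//|/cell_inj_lt ji xi xj].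
  by rewrite (ji xj xi).
rewrite /cell /= !in_itv /= => /andP[_ x_le] /andP[x_gt _].
by have := lt_le_trans x_gt x_le; rewrite ltNge le_grid.
Qed.

Lemma exists_cell k x : - k.+1%:R < x -> x <= k.+1%:R ->
  exists i : 'I_(2 * k.+1 ^ 2), cell k i x.
Proof.
move=> x_gt; rewrite -(grid_last k); elim: (2 * _)%N => [|n IH] x_le.
  by move: x_le; rewrite /grid mul0r add0r leNgt x_gt.
have [/IH[i xi]|lt_x] := leP x (grid k n); first by exists (widen_ord (leqnSn n) i).
by exists ord_max; rewrite /cell /= in_itv /= lt_x.
Qed.

Definition cell_inf g k i : R := inf (g @` `[grid k i, grid k i.+1]).

Lemma cell_inf_le g k i y : (forall x, 0 <= g x) ->
  grid k i <= y <= grid k i.+1 -> cell_inf g k i <= g y.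
Proof.
move=> g_ge0 yI; apply: ge_inf; last by exists y => //=; rewrite in_itv.
by exists 0 => _ [x _ <-].
Qed.

Lemma cell_inf_ge g k i c :
  (forall y, grid k i <= y <= grid k i.+1 -> c <= g y) -> c <= cell_inf g k i.
Proof.
move=> c_le; apply: lb_le_inf.
  by exists (g (grid k i)), (grid k i) => //=; rewrite in_itv /= lexx le_grid.
by move=> _ [y /= + <-]; rewrite in_itv; exact: c_le.
Qed.

Definition lower_step g k x : R :=
  \sum_(i < 2 * k.+1 ^ 2) cell_inf g k i * \1_(cell k i) x.

Lemma lower_stepE g k (i : 'I_(2 * k.+1 ^ 2)) x :
  cell k i x -> lower_step g k x = cell_inf g k i.
Proof.
move=> xi; rewrite /lower_step (bigD1 i) //= big1 => [|j ji].
  by rewrite indicE mem_set // mulr1 addr0.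
rewrite indicE memNset ?mulr0 // => xj.
by move/eqP: ji; apply; apply/val_inj; exact: cell_inj xj xi.
Qed.

Lemma lower_step_ge0 g k x : (forall y, 0 <= g y) -> 0 <= lower_step g k x.
Proof.
by move=> g_ge0; apply: sumr_ge0 => i _; rewrite mulr_ge0 //; exact: cell_inf_ge.
Qed.

Lemma lower_step_le g k x : (forall y, 0 <= g y) -> lower_step g k x <= g x.
Proof.
move=> g_ge0; have [[i xi]|no_cell] := pselect (exists i : 'I_(2 * k.+1 ^ 2), cell k i x).
  rewrite (lower_stepE _ xi) cell_inf_le //.
  by move: xi; rewrite /cell /= in_itv /= => /andP[/ltW -> ->].
rewrite /lower_step big1 // => i _.
by rewrite indicE memNset ?mulr0 // => xi; apply: no_cell; exists i.
Qed.

Lemma cvg_lower_step g x : (forall y, 0 <= g y) -> {for x, continuous g} ->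
  lower_step g k x @[k --> \oo] --> g x.
Proof.
move=> g_ge0 /cvgrPdist_le g_cont; apply/cvgrPdist_le => e e_gt0.
have [r /= r_gt0 g_near] := g_cont e e_gt0.
near=> k; rewrite ger0_norm ?subr_ge0 ?lower_step_le // lerBlDl -lerBlDr.
have x_lt : `|x| < k%:R by near: k; exact: nbhs_infty_gtr.
have : `|x| < k.+1%:R by rewrite (lt_le_trans x_lt) // ler_nat.
rewrite ltr_norml => /andP[x_gt /ltW /(exists_cell x_gt)[i xi]].
rewrite (lower_stepE _ xi); apply: cell_inf_ge => y /andP[y_ge y_le].
have width : k.+1%:R^-1 < r by near: k; exact: (near_infty_natSinv_lt (PosNum r_gt0)).
suff : `|g x - g y| <= e by rewrite ler_distl => /andP[_]; rewrite lerBlDr.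
apply: g_near => /=; move: xi; rewrite /cell /= in_itv /= gridS => /andP[grid_lt x_le].
rewrite gridS in y_le; move: k.+1%:R^-1 width x_le y_le => w width x_le y_le.
by rewrite ltr_distl; apply/andP; split; lra.
Unshelve. all: by end_near. Qed.

Lemma measurable_lower_step g k : measurable_fun setT (lower_step g k).
Proof. by apply: measurable_sum => i; exact: measurable_funM. Qed.

Lemma Rintegral_lower_step (m : probability R R) g k : (forall y, 0 <= g y) ->
  (\int[m]_x lower_step g k x)%R =
  \sum_(i < 2 * k.+1 ^ 2) cell_inf g k i * fine (m (cell k i)).
Proof.
move=> g_ge0; have inf_ge0 i : 0 <= cell_inf g k i by exact: cell_inf_ge.
rewrite /Rintegral /lower_step; under eq_integral do rewrite -sumEFin.
rewrite ge0_integral_sum //=; last 2 first.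
- by move=> i; apply/measurable_EFinP; exact: measurable_funM.
- by move=> i x _; rewrite lee_fin mulr_ge0.
have term i : (\int[m]_x (cell_inf g k i * \1_(cell k i) x)%:E =
    (cell_inf g k i * fine (m (cell k i)))%:E)%E.
  under eq_integral do rewrite EFinM.
  rewrite ge0_integralZl_EFin //=; last by apply/measurable_EFinP; exact: measurable_indic.
  by rewrite integral_indic // setIT EFinM fineK // fin_num_measure.
by under eq_bigr do rewrite term; rewrite sumEFin.
Qed.

End lower_step.

Section weak_convergence.
Context {R : realType}.
Implicit Types (f g : R -> R) (m : probability R R) (mu : nat -> probability R R).

Lemma integrable_bounded m f M : measurable_fun setT f -> (forall x, `|f x| <= M) ->
  m.-integrable setT (EFin \o f).
Proof.
move=> mf fM; apply: measurable_bounded_integrable => //.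
  by rewrite (le_lt_trans (probability_le1 _ _)) ?ltry.
exists M; split=> [|N MN x _ /=]; first exact: num_real.
exact: le_trans (fM x) (ltW MN).
Qed.

Lemma restrict_ge0_le (D : set R) f x :
  (forall y, 0 <= f y) -> 0 <= (f \_ D) x <= f x.
Proof. by move=> f_ge0; rewrite patchE; case: ifP; rewrite ?lexx ?f_ge0. Qed.

Lemma continuous_restrict_open (D : set R) f x :
  open D -> D x -> {for x, continuous f} -> {for x, continuous (f \_ D)}.
Proof.
move=> D_open Dx f_cont; rewrite /prop_for /continuous_at patchE mem_set //.
apply: cvg_trans f_cont; apply: near_eq_cvg; near=> y.
rewrite patchE mem_set //; near: y.
exact: (open_nbhs_nbhs (conj D_open Dx)).
Unshelve. all: by end_near. Qed.

Lemma cvg_Rintegral_lower_step m (D : set R) f M :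
  open D -> m D = 1%E -> continuous f -> (forall x, 0 <= f x <= M) ->
  (\int[m]_x lower_step (f \_ D) k x)%R @[k --> \oo] --> (\int[m]_x f x)%R.
Proof.
move=> D_open mD f_cont f_bd; have f_ge0 x : 0 <= f x by have /andP[] := f_bd x.
have g_ge0 x : 0 <= (f \_ D) x by have /andP[] := restrict_ge0_le D x f_ge0.
have mf : measurable_fun setT (EFin \o f).
  by apply/measurable_EFinP; exact: continuous_measurable_fun.
have m_step k : measurable_fun setT (EFin \o lower_step (f \_ D) k).
  by apply/measurable_EFinP; exact: measurable_lower_step.
have ae_cvg : {ae m, forall x, setT x ->
    (lower_step (f \_ D) k x)%:E @[k --> \oo] --> (f x)%:E}.
  exists (~` D); split.
  - by apply: measurableC; exact: open_measurable.
  - by rewrite probability_setC ?mD ?subee //; exact: open_measurable.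
  - move=> x /= not_cvg Dx; apply: not_cvg => _; apply: cvg_EFin; first by near=> k.
    have -> : f x = (f \_ D) x by rewrite patchE mem_set.
    by apply: cvg_lower_step => //; apply: continuous_restrict_open => //; exact: f_cont.
have dom : {ae m, forall x k, setT x ->
    (`|(lower_step (f \_ D) k x)%:E| <= (cst M%:E) x)%E}.
  apply: aeW => x k _; rewrite /= lee_fin ger0_norm ?lower_step_ge0 //.
  have /andP[_ f_le] := f_bd x; have /andP[_ g_le] := restrict_ge0_le D x f_ge0.
  by rewrite (le_trans (lower_step_le _ _ g_ge0)) // (le_trans g_le).
have int_M := finite_measure_integrable_cst m M measurableT.
have [int_f _] := dominated_convergence measurableT m_step mf ae_cvg int_M dom.
by rewrite -(fineK (integrable_fin_num measurableT int_f)) => /fine_cvg.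
Unshelve. all: by end_near. Qed.

Lemma le_Rintegral_lower_step m (D : set R) f M k :
  continuous f -> (forall x, 0 <= f x <= M) ->
  (\int[m]_x lower_step (f \_ D) k x)%R <= (\int[m]_x f x)%R.
Proof.
move=> f_cont f_bd; have f_ge0 x : 0 <= f x by have /andP[] := f_bd x.
have g_ge0 x : 0 <= (f \_ D) x by have /andP[] := restrict_ge0_le D x f_ge0.
have step_le x : lower_step (f \_ D) k x <= f x.
  by apply: le_trans (lower_step_le _ _ g_ge0) _; have /andP[] := restrict_ge0_le D x f_ge0.
apply: le_Rintegral => //.
- apply: (@integrable_bounded _ _ M); first exact: measurable_lower_step.
  move=> x; have /andP[_ f_le] := f_bd x.
  by rewrite ger0_norm ?lower_step_ge0 // (le_trans (step_le x)).
- apply: (@integrable_bounded _ _ M); first exact: continuous_measurable_fun.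
  by move=> x; rewrite ger0_norm //; have /andP[] := f_bd x.
Qed.

Definition itv_liminf_ge (D : set R) mu m := forall s t, s < t -> `[s, t] `<=` D ->
  liminf_ge (fun n => fine (mu n `]s, t]%classic)) (fine (m `]s, t]%classic)).

Lemma lower_step_liminf_ge mu m (D : set R) f M k :
  itv_liminf_ge D mu m -> (forall x, 0 <= f x <= M) ->
  liminf_ge (fun n => \int[mu n]_x lower_step (f \_ D) k x)%R
    (\int[m]_x lower_step (f \_ D) k x)%R.
Proof.
move=> itv_ge f_bd.
have f_ge0 x : 0 <= f x by have /andP[] := f_bd x.
have g_ge0 x : 0 <= (f \_ D) x by have /andP[] := restrict_ge0_le D x f_ge0.
rewrite Rintegral_lower_step //; under eq_fun do rewrite Rintegral_lower_step //.
apply: liminf_ge_sum => i.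
have [cellD|] := pselect (`[grid k i, grid k i.+1] `<=` D).
  apply: liminf_geZ; first exact: cell_inf_ge.
  by apply: itv_ge => //; rewrite gridS ltrDl invr_gt0.
move=> /existsNP[y /not_implyP[yI Dy]]; suff -> : cell_inf (f \_ D) k i = 0.
  by rewrite mul0r; under eq_fun do rewrite mul0r; exact: liminf_ge0.
apply/eqP; rewrite eq_le cell_inf_ge // andbT.
have <- : (f \_ D) y = 0 by rewrite patchE memNset.
by apply: cell_inf_le => //; move: yI; rewrite /= in_itv.
Qed.

Lemma ge0_Rintegral_liminf_ge mu m (D : set R) f M :
  open D -> m D = 1%E -> itv_liminf_ge D mu m ->
  continuous f -> (forall x, 0 <= f x <= M) ->
  liminf_ge (fun n => \int[mu n]_x f x)%R (\int[m]_x f x)%R.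
Proof.
move=> D_open mD itv_ge f_cont f_bd e e_gt0; have e2_gt0 : 0 < e / 2 by rewrite divr_gt0.
have step_cvg := cvg_Rintegral_lower_step D_open mD f_cont f_bd.
have [k step_ge] : exists k,
    (\int[m]_x f x)%R - e / 2 <= (\int[m]_x lower_step (f \_ D) k x)%R.
  near \oo => k; exists k; near: k; apply: (cvgr_ge _ step_cvg); lra.
near=> n; apply: le_trans (le_Rintegral_lower_step (mu n) D k f_cont f_bd).
have : (\int[m]_x lower_step (f \_ D) k x)%R - e / 2 <=
    (\int[mu n]_x lower_step (f \_ D) k x)%R.
  by near: n; exact: lower_step_liminf_ge.
lra.
Unshelve. all: by end_near. Qed.

Lemma Rintegral_liminf_ge mu m (D : set R) f M :
  open D -> m D = 1%E -> itv_liminf_ge D mu m ->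
  continuous f -> (forall x, `|f x| <= M) ->
  liminf_ge (fun n => \int[mu n]_x f x)%R (\int[m]_x f x)%R.
Proof.
move=> D_open mD itv_ge f_cont f_le e e_gt0.
have shift (q : probability R R) : (\int[q]_x (M + f x))%R = M + (\int[q]_x f x)%R.
  rewrite RintegralD //; last first.
  - by apply: integrable_bounded f_le; exact: continuous_measurable_fun.
  - exact: finite_measure_integrable_cst.
  by rewrite Rintegral_cst // [fine _](congr1 fine (probability_setT q)) mulr1.
have Mf_cont : continuous (fun x => M + f x).
  by move=> x; apply: cvgD; [exact: cvg_cst|exact: f_cont].
have Mf_bd x : 0 <= M + f x <= M + M.
  by have := f_le x; rewrite ler_norml => /andP[? ?]; apply/andP; split; lra.
have := ge0_Rintegral_liminf_ge D_open mD itv_ge Mf_cont Mf_bd e_gt0.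
by apply: filterS => n; rewrite !shift -addrA lerD2l.
Qed.

Lemma weakly_converges_itv mu m (D : set R) :
  open D -> m D = 1%E -> itv_liminf_ge D mu m -> weakly_converges mu m.
Proof.
move=> D_open mD itv_ge f f_cont [M f_le].
have int_f (q : probability R R) : q.-integrable setT (EFin \o f).
  by apply: integrable_bounded f_le; exact: continuous_measurable_fun.
have RintE (q : probability R R) : (\int[q]_x (f x)%:E = (\int[q]_x f x)%R%:E)%E.
  by rewrite fineK // (integrable_fin_num measurableT (int_f q)).
under eq_fun do rewrite RintE.
rewrite RintE; apply: cvg_EFin; first by near=> n.
have Nf_le x : `|- f x| <= M by rewrite normrN.
have Nf_cont : continuous (fun x => - f x) by move=> x; apply: cvgN; exact: f_cont.
have RintN (q : probability R R) : (\int[q]_x - f x)%R = - (\int[q]_x f x)%R.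
  by rewrite -mulN1r -RintegralZl ?int_f //; apply: eq_Rintegral => x _; rewrite mulN1r.
apply/cvgrPdist_le => e e_gt0; near=> n; rewrite ler_distl -lerBlDr; apply/andP; split.
  have : (\int[m]_x - f x)%R - e <= (\int[mu n]_x - f x)%R.
    by near: n; exact: Rintegral_liminf_ge D_open mD itv_ge Nf_cont Nf_le _ e_gt0.
  by rewrite /= !RintN; lra.
by near: n; exact: Rintegral_liminf_ge D_open mD itv_ge f_cont f_le _ e_gt0.
Unshelve. all: by end_near. Qed.

End weak_convergence.

Section root_measure_limit.
Context {R : realType}.
Implicit Types (s t : R).

Lemma root_measure_itvoc (y : nat -> R) n s t :
  root_measure y n.+1 `]s, t]%classic =
  (#|[set k : 'I_n.+1 | s < - y k.+1 <= t]%SET|%:R / n.+1%:R)%:E.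
Proof.
rewrite /root_measure /mscale /= /msum [_ / _]mulrC EFinM; congr (_ * _)%E.
rewrite -sum1_card natr_sum [in RHS]big_mkcond /= -sumEFin; apply: eq_bigr => k _.
by rewrite diracE mem_setE in_itv inE; case: ifP.
Qed.

Lemma root_measure_liminf_ge (x : nat -> nat -> R) :
  (forall n, (1 <= n)%N -> eulerian_roots n (x n)) ->
  itv_liminf_ge `]0, +oo[%classic (fun n => root_measure (x n.+1) n.+1)
    (eulerian_law : probability R R).
Proof.
move=> roots s t st st_pos.
have s_gt0 : 0 < s.
  have /st_pos : `[s, t]%classic s by rewrite /= in_itv /= lexx ltW.
  by rewrite /= in_itv /= andbT.
rewrite [X in fine X](eulerian_law_itvoc s_gt0 (ltW st)) [fine _%:E]/= => e e_gt0.
have two_cvg : 2 / n.+1%:R @[n --> \oo] --> (0 : R).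
  by have := cvg_divn (2 : R); rewrite -cvg_shiftS.
near=> n; rewrite [X in fine X]root_measure_itvoc /= ler_pdivlMr //.
have count : n.+1%:R * (eulerian_cdf t - eulerian_cdf s) - 2 <=
    #|[set k : 'I_n.+1 | s < - x n.+1 k.+1 <= t]%SET|%:R.
  have := roots n.+1 isT; move: (x n.+1); near: n; exact: eulerian_root_count.
have : 2 / n.+1%:R <= e by near: n; exact: (cvgr_le (0 : R)).
by rewrite ler_pdivrMr // => le_e; apply: le_trans count; lra.
Unshelve. all: by end_near. Qed.

End root_measure_limit.

Theorem theorem1 (R : realType) (x : nat -> nat -> R)
    (hx : forall n : nat, (1 <= n)%N -> eulerian_roots n (x n)) :
  exists mu : probability R R,
    [/\ weakly_converges (fun n : nat => root_measure (x n.+1) n.+1) mu,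
        measure_support mu = [set t : R | 0 <= t],
        forall (d : measure_display) (T : measurableType d)
          (P : probability T R) (Z : {RV P >-> R}),
          has_density (distribution P Z) (@standard_cauchy_pdf R) ->
          forall A : set R, measurable A ->
            mu A = distribution P (exp_pi Z) A
      & has_density mu (fun t : R =>
          if 0 < t then (t * (ln t ^+ 2 + pi ^+ 2))^-1 else 0)].
Proof.
exists eulerian_law; split.
- apply: (@weakly_converges_itv _ _ _ `]0, +oo[%classic).
  + exact: interval_open.
  + exact: eulerian_law_itv0y.
  + exact: root_measure_liminf_ge.
- exact: support_eulerian_law.
- by move=> d T P Z cauchyZ A mA; exact: distribution_exp_cauchy.
- exact: has_density_eulerian_law.
Qed.
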